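(* Let $\nu=g\,\mathcal{H}^n=e^{-v}\mathcal{H}^n$ be a log-concave probability measure on $\mathbb{R}^n$ such that $g\in\mathcal{A}'$ and $\nabla^2v\ge c\,\mathrm{Id}$ for some $c>0$. Let $a:\mathbb{R}_+\to\mathbb{R}_+$ be a continuous increasing function with $a(0)=0$. Let $h$ be a positive measurable function of class $C^2(\mathbb{R}^n)$ which satisfies the conditions $$\lim_{\|x\|\to+\infty}\frac{-\log(a(h))+v}{\|x\|}=+\infty\quad\text{and}\quad -c'\,\nabla^2v\le\nabla^2(\log(a(h)))<\nabla^2v\ \text{ for some } c'>0.$$ Then $$\int_{\mathbb{R}^n}a(h)\log a(h)\,d\nu-\Big(\int_{\mathbb{R}^n}a(h)\,d\nu\Big)\log\Big(\int_{\mathbb{R}^n}a(h)\,d\nu\Big)\ \le\ \frac1c\int_{\mathbb{R}^n}\frac{(a'(h))^2}{a(h)}\,\|\nabla h\|^2\,d\nu.$$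
   Context: Fix $n\ge1$; $\mathcal{H}^n$ is Lebesgue measure on $\mathbb{R}^n$ and $\mathbb{R}_+=[0,+\infty)$. $\mathcal{A}'$ is the set of functions $e^{-u}$ where $u:\mathbb{R}^n\to\mathbb{R}$ is convex, of class $C^2(\mathbb{R}^n)$ with positive definite Hessian at every point, and satisfies $\lim_{\|x\|\to+\infty}u(x)/\|x\|=+\infty$. Inequalities between symmetric matrices are in the sense of quadratic forms, at every point of $\mathbb{R}^n$ (strict inequality meaning that the difference is positive definite). *)

(* Defs.v *)
From HB Require Import structures.
From mathcomp Require Import all_boot all_order all_algebra.
From mathcomp Require Import all_classical all_reals all_analysis.
From mathcomp Require Import measurable_realfun.

Set Implicit Arguments.
Unset Strict Implicit.
Unset Printing Implicit Defensive.

Import Order.TTheory GRing.Theory Num.Theory.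
Import numFieldNormedType.Exports.

Local Open Scope classical_set_scope.
Local Open Scope ring_scope.

Notation borel_rV R n := (g_sigma_algebraType (@open 'rV[R]_n)).

(* Cavalieri's principle: the measure of [A] is the integral over the first
   coordinate of the [n]-dimensional measure of the slices of [A]. *)
Fixpoint lebesgue_rV (R : realType) (n : nat) : set (borel_rV R n) -> \bar R :=
  match n with
  | 0 => @dirac _ (borel_rV R 0) (0 : 'rV[R]_0) R
  | n'.+1 => fun A =>
      (\int[lebesgue_measure]_t
         @lebesgue_rV R n'
           [set y | A (row_mx (t%:M : 'rV[R]_1) y : 'rV[R]_(1 + n'))])%E
  end.
Arguments lebesgue_rV {R n}.

Section lebesgue_rV_measure.
Context {R : realType}.

Let rcons0 n (p : measurableTypeR R * borel_rV R n) : borel_rV R n.+1 :=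
  row_mx (p.1%:M : 'rV[R]_1) (p.2 : 'rV[R]_n) : 'rV[R]_(1 + n).

Let runcons n (x : borel_rV R n.+1) : measurableTypeR R * borel_rV R n :=
  ((x : 'rV[R]_(1 + n)) 0 0, rsubmx (x : 'rV[R]_(1 + n))).

Let runconsK n : cancel (@runcons n) (@rcons0 n).
Proof.
move=> x; rewrite /rcons0 /runcons/=.
apply/rowP => i; rewrite mxE; case: splitP => j ij; rewrite !mxE.
  rewrite !ord1/= mulr1n; congr (x _ _); apply/val_inj.
  by rewrite /= ij ord1.
by congr (x _ _); apply/val_inj; rewrite /= ij.
Qed.

Let rconsK n : cancel (@rcons0 n) (@runcons n).
Proof.
case=> t y; rewrite /rcons0 /runcons/= row_mxKr; congr pair.
rewrite mxE; case: splitP => j; last by [].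
by rewrite ord1 mxE mulr1n.
Qed.

Lemma continuous_measurable_rV n m (f : 'rV[R]_n -> 'rV[R]_m) :
  continuous f ->
  measurable_fun [set: borel_rV R n] (f : borel_rV R n -> borel_rV R m).
Proof.
move=> /continuousP cf; apply: (@measurability _ _ (borel_rV R n) (borel_rV R m) _ _ (@open 'rV[R]_m) erefl).
move=> _ [U oU <-]; rewrite setTI; apply: sub_sigma_algebra; exact: cf.
Qed.

Lemma continuous_measurable_rV1 n (f : 'rV[R]_n -> R) :
  continuous f ->
  measurable_fun [set: borel_rV R n] (f : borel_rV R n -> R).
Proof.
move=> /continuousP cf; apply: (measurability _ (RGenOpens.measurableE R)).
move=> _ [_ [a [b ->] <-]]; rewrite setTI; apply: sub_sigma_algebra.
exact/cf/interval_open.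
Qed.

Let measurable_runcons n : measurable_fun setT (@runcons n).
Proof.
apply/measurable_fun_pairP; split.
  apply: continuous_measurable_rV1; exact: coord_continuous.
apply: (@continuous_measurable_rV n.+1 n (fun x => rsubmx (x : 'rV[R]_(1 + n)))).
move=> x A /= /nbhs_ballP[e /= e0 xA]; apply/nbhs_ballP; exists e => //= y xy.
apply: xA; case: xy => _ xy; split=> // i j; rewrite !mxE; exact: xy.
Qed.

Let rat_rV_dense n (x : 'rV[R]_n) (e : R) : 0 < e ->
  exists q : 'rV[rat]_n, ball (map_mx ratr q : 'rV[R]_n) e x.
Proof.
move=> e0.
have /choice[q xq] (i : 'I_n) : exists q : rat, ball (ratr q : R) e (x 0 i).
  have /rat_in_itvoo[q] : x 0 i - e < x 0 i + e by rewrite ltrD2l gtrN.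
  by rewrite in_itv/= -ltr_distlC => qx; exists q; rewrite /ball/= distrC.
exists (\row_i q i); split=> // i j; rewrite !mxE (ord1 i); exact: xq.
Qed.

Let open_rat_balls n (U : set 'rV[R]_n) : open U ->
  U = \bigcup_(p in [set p : 'rV[rat]_n * nat |
        ball (map_mx ratr p.1 : 'rV[R]_n) p.2.+1%:R^-1 `<=` U])
      ball (map_mx ratr p.1 : 'rV[R]_n) p.2.+1%:R^-1.
Proof.
move=> oU; apply/seteqP; split => [x Ux|x [p /= pU]]; last exact: pU.
have /nbhs_ballP[e /= e0 xU] : nbhs x U by exact: open_nbhs_nbhs.
have [k ke] : exists k, k.+1%:R^-1 < e / 2 :> R.
  have [k _ /(_ k (leqnn k))] := near_infty_natSinv_lt (PosNum (divr_gt0 e0 (ltr0n _ 2))).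
  by exists k.
have k0 : 0 < k.+1%:R^-1 :> R by rewrite invr_gt0.
have [q qx] := rat_rV_dense x k0.
exists (q, k) => //= y qy; apply: xU.
rewrite (splitr e); apply: (@ball_triangle _ _ (map_mx ratr q : 'rV[R]_n)).
  by apply/ball_sym/(le_ball (ltW ke)).
by apply/(le_ball (ltW ke)).
Qed.

Let measurable_rcons0 n : measurable_fun setT (@rcons0 n).
Proof.
apply: (@measurability _ _ _ (borel_rV R n.+1) _ _ (@open 'rV[R]_n.+1) erefl).
move=> _ [U /open_rat_balls-> <-]; rewrite setTI preimage_bigcup.
rewrite bigcup_mkcond; apply: countable_bigcupT_measurable => //.
move=> p; case: ifPn => // _.
set q := map_mx _ _.
rewrite (_ : _ @^-1` _ = ball (runcons q).1 p.2.+1%:R^-1 `*`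
    ball (runcons q).2 p.2.+1%:R^-1); last first.
  rewrite -{1}[q](runconsK q); case: (runcons q) => s z.
  apply/seteqP; split => -[t y].
    move=> [e0 qty]; split.
      by have := qty 0 0; rewrite -![_ 0 0]/(runcons _).1 !rconsK.
    split=> // i j; have := qty 0 (rshift 1 j : 'I_(1 + n)).
    by rewrite (ord1 i) /rcons0 (@row_mxEr _ 1 1 n) (@row_mxEr _ 1 1 n).
  move=> [/= st [e0 zy]]; split=> // i j; rewrite (ord1 i).
  rewrite /rcons0; case: (splitP (j : 'I_(1 + n))) => k jk.
    have -> : j = lshift n k by exact/val_inj.
    by rewrite (@row_mxEl _ 1 1 n) (@row_mxEl _ 1 1 n) (ord1 k) !mxE !mulr1n.
  have -> : j = rshift 1 k by exact/val_inj.
  by rewrite (@row_mxEr _ 1 1 n) (@row_mxEr _ 1 1 n).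
apply: measurableX; first exact: measurable_ball.
apply: sub_sigma_algebra; exact: ball_open.
Qed.

Let is_lebesgue_rV n :
  exists m : {sigma_finite_measure set (borel_rV R n) -> \bar R},
    @lebesgue_rV R n = m.
Proof.
elim: n => [|n [m mE]].
  by exists (@dirac _ (borel_rV R 0) (0 : 'rV[R]_0) R).
pose lm :
    {measure set (measurableTypeR R * borel_rV R n)%type -> \bar R} :=
  (lebesgue_measure \x m)%E.
pose pm : {measure set (borel_rV R n.+1) -> \bar R} :=
  measure_function.measure_function_pushforward__canonical__measure_function_Measure
    lm (@measurable_rcons0 n).
have pmE : @lebesgue_rV R n.+1 = pm.
  apply/funext => A /=; rewrite mE.
  apply: eq_integral => t _ /=; congr (m _).
  by apply/seteqP; split => y /=; rewrite /xsection/= inE.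
have sf : sigma_finite setT pm.
  have /sigma_finiteP[F [TF ndF Foo]] := sigma_finiteT (@lebesgue_measure R).
  have /sigma_finiteP[G [TG ndG Goo]] := sigma_finiteT m.
  exists (fun k => @runcons n @^-1` (F k `*` G k)).
    rewrite -preimage_bigcup -[LHS](preimage_setT (@runcons n)); congr (_ @^-1` _).
    apply/esym; rewrite -subTset => -[t y] _.
    have [k _ Fkt] : (\bigcup_k F k) t by rewrite -TF.
    have [l _ Gly] : (\bigcup_k G k) y by rewrite -TG.
    exists (maxn k l) => //; split.
      by move: t Fkt; exact/subsetPset/ndF/leq_maxl.
    by move: y Gly; exact/subsetPset/ndG/leq_maxr.
  move=> k; have [mF Fk] := Foo k; have [mG Gk] := Goo k; split.
    rewrite -[X in measurable X]setTI; apply: measurable_runcons => //.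
    exact: measurableX.
  rewrite /= /pushforward -comp_preimage (_ : _ \o _ = id); last first.
    by apply/funext => x; exact: rconsK.
  by rewrite product_measure1E// lte_mul_pinfty// ge0_fin_numE.
pose S : {sigma_finite_measure set (borel_rV R n.+1) -> \bar R} :=
  HB.pack (Measure.sort pm) (Measure_isSigmaFinite.Build _ _ _ pm sf).
by exists S; rewrite pmE.
Qed.

Let lebesgue_rV0 n : @lebesgue_rV R n set0 = 0%E.
Proof. by have [m ->] := is_lebesgue_rV n; exact: measure0. Qed.

Let lebesgue_rV_ge0 n A : (0 <= @lebesgue_rV R n A)%E.
Proof. by have [m ->] := is_lebesgue_rV n; exact: measure_ge0. Qed.

Let lebesgue_rV_sigma_additive n : semi_sigma_additive (@lebesgue_rV R n).
Proof.
by have [m ->] := is_lebesgue_rV n; exact: measure_semi_sigma_additive.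
Qed.

HB.instance Definition _ n := isMeasure.Build _ _ _ (@lebesgue_rV R n)
  (lebesgue_rV0 n) (@lebesgue_rV_ge0 n) (@lebesgue_rV_sigma_additive n).

Let lebesgue_rV_sigma_finite n : sigma_finite setT (@lebesgue_rV R n).
Proof. by have [m ->] := is_lebesgue_rV n; exact: sigma_finiteT. Qed.

HB.instance Definition _ n := Measure_isSigmaFinite.Build _ _ _
  (@lebesgue_rV R n) (@lebesgue_rV_sigma_finite n).

Let rcons_0 n (t : R) (y : 'rV[R]_n) :
  (row_mx (t%:M : 'rV[R]_1) y : 'rV[R]_(1 + n)) 0 (ord0 : 'I_n.+1) = t.
Proof. by have [] := rconsK (t, y). Qed.

Let rcons_lift n (t : R) (y : 'rV[R]_n) (i : 'I_n) :
  (row_mx (t%:M : 'rV[R]_1) y : 'rV[R]_(1 + n)) 0 (lift ord0 i : 'I_n.+1) =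
  y 0 i.
Proof.
rewrite (_ : (lift ord0 i : 'I_n.+1) = rshift 1 i :> 'I_(1 + n)).
  by rewrite (@row_mxEr _ 1 1 n).
exact/val_inj.
Qed.

Lemma lebesgue_rV_box n (A : 'I_n -> set (measurableTypeR R)) :
  (forall i, measurable (A i)) ->
  (lebesgue_rV [set x : borel_rV R n | forall i, A i ((x : 'rV[R]_n) ord0 i)] =
   \prod_(i < n) lebesgue_measure (A i))%E.
Proof.
elim: n A => [|n IH] A mA.
  rewrite big_ord0 /= diracE mem_set//= => -[]//.
rewrite big_ord_recl -IH//.
set B := [set y : borel_rV R n | _].
rewrite /= -(setIT (A ord0)) -integral_indic//.
rewrite -ge0_integralZr//; last exact/measurable_EFinP/measurable_indic.
apply: eq_integral => t _; rewrite indicE.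
have [At|At] := boolP (t \in A ord0).
  rewrite mul1e; congr (lebesgue_rV _); apply/seteqP; split => y /= Ay i.
    by have := Ay (lift ord0 i); rewrite rcons_lift.
  case: (unliftP ord0 i) => [j ->|->]; first by rewrite rcons_lift.
  by rewrite rcons_0; rewrite inE in At.
rewrite mul0e -[RHS](lebesgue_rV0 n); congr (lebesgue_rV _).
apply/seteqP; split => // y /= /(_ ord0).
by rewrite rcons_0 => /mem_set; rewrite (negbTE At).
Qed.

End lebesgue_rV_measure.

Section calculus_rV.
Context {R : realType} {n : nat}.
Implicit Types (f : 'rV[R]_n -> R) (x w : 'rV[R]_n) (A B : 'M[R]_n).

(* The library norm on ['rV[R]_n] is the sup norm. *)
Definition norm2 x : R := Num.sqrt (\sum_(i < n) x 0 i ^+ 2).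

Definition partial (i : 'I_n) f : 'rV[R]_n -> R := 'D_(delta_mx 0 i) f.

Definition gradient f x : 'rV[R]_n := \row_(i < n) partial i f x.

Definition hessian f x : 'M[R]_n :=
  \matrix_(i < n, j < n) partial i (partial j f) x.

Definition twice_differentiable f : Prop :=
  (forall x, differentiable f x) /\ (forall x, differentiable (gradient f) x).

Definition class_C2 f : Prop :=
  twice_differentiable f /\ continuous (hessian f).

Definition quadform A w : R := (w *m A *m w^T) 0 0.

Definition mx_le A B : Prop := forall w, quadform A w <= quadform B w.

Definition mx_lt A B : Prop :=
  forall w, w != 0 -> quadform A w < quadform B w.

(* [u x / norm2 x] tends to [+oo] as [norm2 x] tends to [+oo]. *)
Definition superlinear (u : 'rV[R]_n -> R) : Prop :=
  forall M : R, \forall r \near +oo,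
    forall x, r <= norm2 x -> M <= u x / norm2 x.

Definition classA' : set ('rV[R]_n -> R) :=
  [set g | exists u : 'rV[R]_n -> R,
    [/\ convex_function setT u,
        class_C2 u,
        (forall x, mx_lt 0 (hessian u x)),
        superlinear u &
        g = (fun x => expR (- u x))]].

End calculus_rV.

(* Main.v *)
Require Import Defs.
From HB Require Import structures.
From mathcomp Require Import all_boot all_order all_algebra.
From mathcomp Require Import all_classical all_reals all_analysis.
From mathcomp Require Import measurable_realfun.
From mathcomp Require Import ring lra.

Set Implicit Arguments.
Unset Strict Implicit.
Unset Printing Implicit Defensive.

Import Order.TTheory GRing.Theory Num.Theory.
Import numFieldNormedType.Exports.

Local Open Scope classical_set_scope.
Local Open Scope ring_scope.

(** Put [phi := ln (a (h x))] and [F := expR phi].  The chain rule turns the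
    integrand on the right into [F * |grad phi|^2], so the claim is a logarithmic
    Sobolev inequality for the measure [nu] of density [e^-v] with Hessian of [v]
    at least [c]:

      Ent_nu(F) <= (1/c) int F |grad phi|^2 dnu.

    The sharp constant is [1/(2c)]; the factor 2 of slack pays for a cutoff.

    For a bounded function [psi] the sharp inequality is read off the
    Prekopa-Leindler inequality, as Bobkov and Ledoux do.  Apply it with a weight
    [t] close to 1 to [e^(psi/t - v)], [e^-v] and [e^(chi - v)].  By strong
    convexity of [v] ([strongly_convex]) its hypothesis holds as soon as
      psi x - c t / (2 (1 - t)) |x - z|^2 <= chi z   for all x and z,
    and the least such [chi] is [psi + (1 - t) |grad psi|^2 / (2c)] up to
    [o(1 - t)].  The conclusion
      (int e^(psi/t) dnu)^t <= int e^chi dnu         ([prekopa_leindler_dual])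
    is an equality at [t = 1]; comparing the first-order terms there gives the
    entropy on the left and the energy on the right ([log_sobolev_bounded]).

    The general case is reached from [psi = ln (1/rho + eta^2 F)] with
    [eta = max 0 (1 - |x|^2/rho^2)].  This function is constant outside a ball, so
    the bounded case applies; [(a + b)^2 <= 2 a^2 + 2 b^2] bounds its energy by
    [2 int F |grad phi|^2 + (32/rho^2) int F] ([truncation_energy]).  When [rho]
    tends to infinity the entropy passes to the limit by Fatou's lemma, since
    [y ln y >= -1] ([log_sobolev_integrable]).  If [F] is not integrable the left
    side is [-oo], and if the energy is infinite the right side is [+oo].

    The Prekopa-Leindler inequality is proved by induction on the dimension.  The
    measure [lebesgue_rV] is defined by slicing, so the inductive step is Tonelli's
    theorem followed by the one-dimensional case; the latter integrates the
    Brunn-Minkowski inequality over the superlevel sets of the functions. *)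

(** * Brunn-Minkowski and Prekopa-Leindler on the line *)

(** Tonelli's theorem on the set of pairs [(x, l)] with [0 < l < 1] and
    [l < f x].  Restricting the levels to [(0, 1)] suits functions that have been
    divided by their supremum. *)
Lemma layer_cake_01 d (T : measurableType d) (R : realType)
    (m : {sigma_finite_measure set T -> \bar R}) (f : T -> \bar R) :
  measurable_fun setT f -> (forall x, (0 <= f x)%E) ->
  (\int[lebesgue_measure]_(l in `]0%R, 1%R[) m [set x | (l%:E < f x)%E] =
   \int[m]_x mine (f x) 1)%E.
Proof.
move=> mf f0.
pose D : set (T * measurableTypeR R) :=
  [set p | (p.2 \in `]0, 1[) && (p.2%:E < f p.1)%E].
have mlt : measurable [set p : T * measurableTypeR R | (p.2%:E < f p.1)%E].
  rewrite -[X in measurable X]setTI; apply: emeasurable_fun_lt => //.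
    exact: measurableT_comp.
  exact: measurableT_comp mf _.
have mD : measurable D.
  rewrite (_ : D = setT `*` `]0, 1[%classic `&`
      [set p | (p.2%:E < f p.1)%E]); last first.
    by apply/seteqP; split => -[x l] /=; [case/andP|case=> -[_ ? ?]; apply/andP].
  by apply: measurableI => //; exact: measurableX.
transitivity (\int[lebesgue_measure]_l \int[m]_x (\1_D (x, l))%:E)%E.
  rewrite integral_mkcond; apply: eq_integral => l _; rewrite patchE.
  case: ifPn => l01; last first.
    rewrite integral0_eq// => x _; rewrite indicE memNset// /D/=.
    by move: l01; rewrite mem_setE => /negbTE ->.
  rewrite -[X in m X]setTI -[X in m X]setIC -integral_indic//; last first.
    have := @measurable_ysection _ _ _ _ _ l mlt.
    by congr measurable; apply/seteqP; split => x; rewrite /ysection/= inE.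
  apply: eq_integral => x _; congr (_%:E); rewrite !indicE; congr ((_ : bool)%:R).
  rewrite mem_setE in l01.
  by apply/idP/idP; rewrite !inE /D/= l01.
rewrite -(fubini_tonelli (fun p => (\1_D p)%:E)); last 2 first.
- exact/measurable_EFinP/measurable_indic.
- by move=> p; rewrite lee_fin.
apply: eq_integral => x _.
rewrite (_ : (fun y => _) = (fun y => (\1_[set l : R | D (x, l)] y)%:E)); last first.
  by apply/funext => y; rewrite !indicE; congr ((_ : bool)%:R%:E); apply/idP/idP; rewrite !inE.
rewrite integral_indic//; last first.
  have := @measurable_xsection _ _ _ _ _ x mD.
  by congr measurable; apply/seteqP; split => y; rewrite /xsection/= inE.
rewrite setIT.
have [fx1|fx1] := leP 1%E (f x).
  transitivity (lebesgue_measure (`]0%R, 1%R[%classic : set R)); last first.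
    by rewrite lebesgue_measure_itv/= lte01 oppr0 adde0.
  congr (lebesgue_measure _); apply/seteqP; split => y; rewrite /D/=; first by case/andP.
  move=> y01; rewrite y01/=; apply: lt_le_trans fx1; rewrite lte_fin.
  by move: y01; rewrite in_itv/= => /andP[].
have ffin : f x \is a fin_num by rewrite ge0_fin_numE// (lt_trans fx1)// ltry.
transitivity (lebesgue_measure (`]0%R, fine (f x)[%classic : set R)); last first.
  rewrite lebesgue_measure_itv/= fineK// oppr0 adde0.
  by rewrite lt_neqAle f0 andbT; case: eqP => //= <-.
congr (lebesgue_measure _).
apply/seteqP; split => y; rewrite /D/= !in_itv/=.
  by move=> /andP[/andP[-> _]]; rewrite -{1}(fineK ffin) lte_fin => ->.
move=> /andP[-> yf]; rewrite -(fineK ffin) lte_fin yf andbT/=.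
by rewrite (lt_trans yf)// -lte_fin fineK.
Qed.

(** Image of [A] under [x |-> t x + b], written as a preimage
    so that its measurability is immediate. *)
Lemma lebesgue_measure_affine (R : realType) (t b : R) (A : set R) : 0 < t ->
  measurable A ->
  lebesgue_measure ((fun x => t^-1 * (x - b)) @^-1` A) =
  (t%:E * lebesgue_measure A)%E.
Proof.
move=> t0 mA.
pose phi (x : measurableTypeR R) : measurableTypeR R := t^-1 * (x - b).
have mphi : measurable_fun setT phi.
  by apply: measurable_funM => //; exact: measurable_funB.
pose pm : {measure set (measurableTypeR R) -> \bar R} :=
  measure_function.measure_function_pushforward__canonical__measure_function_Measure
    (@lebesgue_measure R) mphi.
have tV : 0 <= t^-1 by rewrite invr_ge0 ltW.
rewrite [in RHS](@lebesgue_measure_unique _ (mscale (NngNum tV) pm))//.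
  by rewrite /mscale/= muleA -EFinM divff ?gt_eqF// mul1e.
move=> _ [[x y] _ <-].
rewrite /mscale/= /pushforward.
transitivity (t^-1%:E * lebesgue_measure (`](t * x + b)%R, (t * y + b)%R]%classic : set R))%E.
  rewrite !lebesgue_measure_itv/= !lte_fin ltrD2r ltr_pM2l//.
  case: ifPn => _; last by rewrite mule0.
  rewrite -EFinD -EFinM; congr (_%:E); field.
  by rewrite gt_eqF.
congr (_ * lebesgue_measure _)%E; apply/seteqP; split => z; rewrite /phi/= !in_itv/=;
  rewrite [_^-1 * _]mulrC ltr_pdivlMr// ler_pdivrMr// ltrBrDr lerBlDr;
  by rewrite (mulrC x) (mulrC y).
Qed.

(** With [x0] in [A] close to [sup A] and [y0] in [B] close to [inf B], the
    translates [t A + (1 - t) y0] and [t x0 + (1 - t) B] both lie in [C] and meet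
    in an interval of length at most [e].  No sum set appears, so its
    measurability is not an issue. *)
Lemma brunn_minkowski_1d (R : realType) (t : R) (A B C : set R) :
  0 < t < 1 ->
  measurable A -> measurable B -> measurable C -> has_sup A -> has_inf B ->
  (forall x y, A x -> B y -> C (t * x + (1 - t) * y)) ->
  (t%:E * lebesgue_measure A + (1 - t)%:E * lebesgue_measure B
   <= lebesgue_measure C)%E.
Proof.
move=> /andP[t0 t1] mA mB mC supA infB ABC.
have s0 : 0 < 1 - t by rewrite subr_gt0.
have {}maff u b (D : set R) : measurable D ->
    measurable ((fun x : R => u * (x - b)) @^-1` D).
  move=> mD; rewrite -[X in measurable X]setTI.
  suff : measurable_fun setT (fun x : R => u * (x - b)) by exact.
  by apply: measurable_funM => //; exact: measurable_funB.
apply/lee_addgt0Pr => e e0.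
have [x0 Ax0 x0A] := sup_adherent e0 supA.
have [y0 By0 y0B] := inf_adherent e0 infB.
set X := (fun x : R => t^-1 * (x - (1 - t) * y0)) @^-1` A.
set Y := (fun y : R => (1 - t)^-1 * (y - t * x0)) @^-1` B.
have mX : measurable X by exact: maff.
have mY : measurable Y by exact: maff.
rewrite -(lebesgue_measure_affine ((1 - t) * y0) t0 mA) -/X.
rewrite -(lebesgue_measure_affine (t * x0) s0 mB) -/Y.
have XYe : (lebesgue_measure (Y `&` X) <= e%:E)%E.
  pose I : set R :=
    `[(t * x0 + (1 - t) * inf B), (t * sup A + (1 - t) * y0)]%classic.
  apply: (@le_trans _ _ (lebesgue_measure I)).
    apply: le_measure; rewrite ?inE; [exact: measurableI|exact: measurable_itv|].
    move=> z [/= Bz Az]; suff: z \in `[(t * x0 + (1 - t) * inf B), (t * sup A + (1 - t) * y0)] by [].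
    rewrite in_itv/=; apply/andP; split.
      have : inf B <= (1 - t)^-1 * (z - t * x0) by apply: ge_inf => //; exact: infB.2.
      by rewrite ler_pdivlMl// lerBrDl.
    have : t^-1 * (z - (1 - t) * y0) <= sup A by apply: ub_le_sup => //; exact: supA.2.
    by rewrite ler_pdivrMl// lerBlDr.
  rewrite /I lebesgue_measure_itv/=; case: ifPn => _; last by rewrite lee_fin ltW.
  rewrite -EFinB lee_fin.
  have : t * (sup A - x0) <= t * e by rewrite ler_pM2l// lerBlDr -lerBlDl ltW.
  have : (1 - t) * (y0 - inf B) <= (1 - t) * e.
    by rewrite ler_pM2l// lerBlDr addrC ltW.
  lra.
have XYC : X `|` Y `<=` C.
  move=> z [Xz|Yz].
    have := ABC _ _ Xz By0; congr C; field; exact: lt0r_neq0.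
  have := ABC _ _ Ax0 Yz; congr C; field; exact: lt0r_neq0.
rewrite (measureDI lebesgue_measure mY mX) addeA.
apply: leeD => //.
have mYX : measurable (Y `\` X) by exact: measurableD.
rewrite -measureU//; last first.
  by rewrite setDE setICA setICr setI0.
apply: le_measure; rewrite ?inE; [exact: measurableU|by []|].
by move=> z [?|[? _]]; apply: XYC; [left|right].
Qed.

(** The relation [p^t q^(1-t) <= r] between extended nonnegative numbers,
    expressed by real numbers below [p] and [q] to avoid powers of [+oo] and
    products of [0] and [+oo]. *)
Definition geomean_le (R : realType) (t : R) (p q r : \bar R) :=
  forall a b : R, 0 < a -> 0 < b -> (a%:E < p)%E -> (b%:E < q)%E ->
    ((a `^ t * b `^ (1 - t))%:E <= r)%E.

(** Concavity of the logarithm, through [ln y <= y - 1] at [a / m] and [b / m]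
    with [m] the arithmetic mean. *)
Lemma powR_amgm (R : realType) (t a b : R) : 0 < t < 1 -> 0 < a -> 0 < b ->
  a `^ t * b `^ (1 - t) <= t * a + (1 - t) * b.
Proof.
move=> /andP[t0 t1] a0 b0.
rewrite -ler_ln ?posrE ?mulr_gt0 ?powR_gt0//; last first.
  by rewrite addr_gt0// mulr_gt0// subr_gt0.
rewrite lnM ?posrE ?powR_gt0// !ln_powR.
pose m := t * a + (1 - t) * b.
have m0 : 0 < m by rewrite addr_gt0// mulr_gt0// subr_gt0.
have H c : 0 < c -> ln c <= ln m + (c / m - 1).
  move=> c0; have cm0 : 0 < c / m by rewrite divr_gt0.
  have /le_ln1Dx : -1 < c / m - 1 by lra.
  rewrite (_ : 1 + (c / m - 1) = c / m); last by ring.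
  by rewrite ln_div ?posrE// lerBlDr addrC.
have Ha : t * ln a <= t * (ln m + (a / m - 1)) by rewrite ler_pM2l// H.
have Hb : (1 - t) * ln b <= (1 - t) * (ln m + (b / m - 1)).
  by rewrite ler_pM2l ?subr_gt0// H.
apply: le_trans (lerD Ha Hb) _.
rewrite [leLHS](_ : _ = ln m + (m / m - 1)); last by rewrite /m; ring.
by rewrite divff ?gt_eqF// subrr addr0.
Qed.

Lemma measurable_fun_superlevel d (T : measurableType d) (R : realType)
    (m : {sigma_finite_measure set T -> \bar R}) (f : T -> \bar R) :
  measurable_fun setT f ->
  measurable_fun (setT : set (measurableTypeR R))
    (fun l : R => m [set x | (l%:E < f x)%E]).
Proof.
move=> mf.
have mlt : measurable [set p : T * measurableTypeR R | (p.2%:E < f p.1)%E].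
  rewrite -[X in measurable X]setTI; apply: emeasurable_fun_lt => //.
    exact: measurableT_comp.
  exact: measurableT_comp mf _.
have := measurable_fun_ysection m mlt.
congr measurable_fun; apply/funext => l /=; congr (m _).
by apply/seteqP; split => x; rewrite /ysection/= inE.
Qed.

(** After division of [u] and [v] by their suprema [S] and [T], all the
    superlevel sets at levels in [(0, 1)] are nonempty, so Brunn-Minkowski bounds
    below the superlevel sets of [w / (S^t T^(1-t))]; integrating over the levels
    gives an arithmetic mean of integrals, which dominates the geometric one. *)
Lemma prekopa_leindler_bounded (R : realType) (t N : R) (u v : R -> R)
    (w : R -> \bar R) : 0 < t < 1 ->
  measurable_fun setT u -> measurable_fun setT v -> measurable_fun setT w ->
  (forall x, 0 <= u x <= N) -> (forall x, 0 <= v x <= N) ->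
  (forall x, 0 <= w x)%E ->
  (forall x, N < `|x| -> u x = 0) -> (forall x, N < `|x| -> v x = 0) ->
  (forall x y, geomean_le t (u x)%:E (v y)%:E (w (t * x + (1 - t) * y))) ->
  geomean_le t (\int[lebesgue_measure]_x (u x)%:E)
    (\int[lebesgue_measure]_x (v x)%:E) (\int[lebesgue_measure]_x w x).
Proof.
move=> t01 mu mv mw uN vN w0 uN0 vN0 H a b a0 b0 aU bV.
have /andP[t0 t1] := t01; have s0 : 0 < 1 - t by rewrite subr_gt0.
(* A positive integral forces a positive supremum, by which to divide. *)
have sup_pos f : (forall x, 0 <= f x <= N) ->
    (0 < \int[lebesgue_measure]_x (f x)%:E)%E ->
    [/\ has_sup (range f), 0 < sup (range f) & forall x, f x <= sup (range f)].
  move=> fN intf.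
  have hs : has_sup (range f).
    by split; [exists (f 0), 0|exists N => _ [x _ <-]; case/andP: (fN x)].
  have fsup x : f x <= sup (range f).
    by apply: ub_le_sup; [exact: hs.2|exists x].
  split=> //; rewrite ltNge; apply: contraTN intf => S0.
  rewrite integral0_eq ?ltxx// => x _; congr (_%:E); apply/eqP.
  by rewrite eq_le (le_trans (fsup x) S0)/=; case/andP: (fN x).
have [hS S0 uS] := sup_pos _ uN (lt_trans (a0 : (0%:E < a%:E)%E) aU).
have [hT T0 vT] := sup_pos _ vN (lt_trans (b0 : (0%:E < b%:E)%E) bV).
move: {sup_pos} hS S0 uS hT T0 vT.
set S := sup (range u); set T := sup (range v) => hS S0 uS hT T0 vT.
pose k := S `^ t * T `^ (1 - t).
have k0 : 0 < k by rewrite mulr_gt0// powR_gt0.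
pose fu x := (u x / S)%:E; pose fv x := (v x / T)%:E.
pose fw x := (k^-1%:E * w x)%E.
have mfu : measurable_fun setT fu.
  by apply/measurable_EFinP; exact: measurable_funM.
have mfv : measurable_fun setT fv.
  by apply/measurable_EFinP; exact: measurable_funM.
have mfw : measurable_fun setT fw by exact: measurable_funeM.
have fu0 x : (0 <= fu x)%E.
  by rewrite lee_fin divr_ge0 ?(ltW S0)//; case/andP: (uN x).
have fv0 x : (0 <= fv x)%E.
  by rewrite lee_fin divr_ge0 ?(ltW T0)//; case/andP: (vN x).
have fw0 x : (0 <= fw x)%E by rewrite mule_ge0// lee_fin invr_ge0 ltW.
have msup (f : R -> \bar R) l : measurable_fun setT f ->
    measurable [set x | (l%:E < f x)%E].
  by move=> mf; rewrite -[X in measurable X]setTI; exact: emeasurable_fun_o_infty.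
have hadh (f : R -> R) M l : 0 < M -> sup (range f) = M -> has_sup (range f) ->
    l < 1 -> exists x, l < f x / M.
  move=> M0 fM hf l1; have e0 : 0 < (1 - l) * M by rewrite mulr_gt0// subr_gt0.
  have [_ [x _ <-]] := sup_adherent e0 hf; rewrite fM => fx.
  by exists x; rewrite ltr_pdivlMr//; lra.
have bnd (f : R -> R) M l : (forall x, N < `|x| -> f x = 0) -> 0 < l ->
    forall x, l < f x / M -> - N <= x <= N.
  move=> fN l0 x; rewrite -ler_norml; apply: contraTT; rewrite -!leNgt -ltNge.
  by move=> /fN ->; rewrite mul0r ltW.
have BM l : 0 < l < 1 ->
    (t%:E * lebesgue_measure [set x | (l%:E < fu x)%E] +
     (1 - t)%:E * lebesgue_measure [set x | (l%:E < fv x)%E] <=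
     lebesgue_measure [set x | (l%:E < fw x)%E])%E.
  move=> /andP[l0 l1]; apply: brunn_minkowski_1d => //; try exact: msup.
  - have [x lx] := hadh u S l S0 erefl hS l1; split; first by exists x => /=.
    by exists N => y /= /(bnd u S l uN0 l0) /andP[].
  - have [x lx] := hadh v T l T0 erefl hT l1; split; first by exists x => /=.
    by exists (- N) => y /= /(bnd v T l vN0 l0) /andP[].
  - move=> x y; rewrite /fu /fv /fw/= !lte_fin => lx ly.
    have lm : l < Num.min (u x / S) (v y / T) by rewrite lt_min lx ly.
    (* A level slightly above [l] makes the inequality for [w] strict. *)
    have [l' ll' l'm] : exists2 l', l < l' & l' < Num.min (u x / S) (v y / T).
      by exists ((l + Num.min (u x / S) (v y / T)) / 2); lra.
    have l'0 : 0 < l' by rewrite (lt_trans l0).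
    move: l'm; rewrite lt_min => /andP[].
    rewrite !ltr_pdivlMr// => l'u l'v.
    have := H x y (l' * S) (l' * T); rewrite !lte_fin => /(_ _ _ l'u l'v).
    rewrite !mulr_gt0// => /(_ isT isT).
    rewrite (powRM _ (ltW l'0) (ltW S0)) (powRM _ (ltW l'0) (ltW T0)) mulrACA.
    rewrite -powRD; last by rewrite (gt_eqF l'0) implybT.
    rewrite addrC subrK (powRr1 (ltW l'0)) -/k => kw.
    rewrite lte_pdivlMl// -EFinM.
    by apply: lt_le_trans kw; rewrite lte_fin mulrC ltr_pM2r.
have mD : measurable (`]0%R, 1%R[%classic : set (measurableTypeR R)) by [].
have mmu : measurable_fun setT
    (fun l : measurableTypeR R => lebesgue_measure [set x | (l%:E < fu x)%E]).
  exact: measurable_fun_superlevel.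
have mmv : measurable_fun setT
    (fun l : measurableTypeR R => lebesgue_measure [set x | (l%:E < fv x)%E]).
  exact: measurable_fun_superlevel.
have mmw : measurable_fun setT
    (fun l : measurableTypeR R => lebesgue_measure [set x | (l%:E < fw x)%E]).
  exact: measurable_fun_superlevel.
have le_int : (t%:E * \int[lebesgue_measure]_x fu x +
    (1 - t)%:E * \int[lebesgue_measure]_x fv x <=
    \int[lebesgue_measure]_x fw x)%E.
  have le1 (f : R -> R) M : (forall x, f x <= M) -> 0 < M ->
     (\int[lebesgue_measure]_x (f x / M)%:E =
      \int[lebesgue_measure]_x (mine (f x / M)%:E 1%:E))%E.
    move=> fM M0; apply: eq_integral => x _; rewrite min_l// lee_fin.
    by rewrite ler_pdivrMr// mul1r.
  have lc (f : R -> \bar R) : measurable_fun setT f -> (forall x, (0 <= f x)%E) ->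
     (\int[lebesgue_measure]_x mine (f x) 1 = \int[lebesgue_measure]_(l in `]0%R, 1%R[)
        lebesgue_measure [set x | (l%:E < f x)%E])%E.
    by move=> mf f0; exact/esym/layer_cake_01.
  rewrite (le1 u S)// (le1 v T)// (lc fu)// (lc fv)//.
  apply: (@le_trans _ _ (\int[lebesgue_measure]_x mine (fw x) 1)%E); last first.
    apply: ge0_le_integral => //.
    - by move=> x _; rewrite le_min fw0 lee01.
    - exact: measurable_mine.
    - by move=> x _; rewrite ge_min lexx.
  rewrite (lc fw)//.
  rewrite -!ge0_integralZl//; try exact: measurable_funTS.
  2,3: by rewrite lee_fin ltW.
  rewrite -ge0_integralD//; last 4 first.
  - by move=> l _; rewrite mule_ge0// lee_fin ltW.
  - by apply: measurable_funeM; exact: measurable_funTS.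
  - by move=> l _; rewrite mule_ge0// lee_fin ltW.
  - by apply: measurable_funeM; exact: measurable_funTS.
  apply: ge0_le_integral => //.
  - by move=> l _; rewrite adde_ge0// mule_ge0// lee_fin ltW.
  - by apply: emeasurable_funD; apply: measurable_funeM; exact: measurable_funTS.
  - exact: measurable_funTS.
have intM (f : R -> R) M c : measurable_fun setT f -> (forall x, 0 <= f x <= N) ->
    0 < M -> (c%:E < \int[lebesgue_measure]_x (f x)%:E)%E ->
    ((c / M)%:E <= \int[lebesgue_measure]_x (f x / M)%:E)%E.
  move=> mf fN M0 /ltW cf.
  under eq_integral do rewrite mulrC EFinM.
  rewrite ge0_integralZl//.
  - by rewrite mulrC EFinM lee_pmul2l// ?lte_fin ?invr_gt0.
  - exact/measurable_EFinP.
  - by move=> x _; rewrite lee_fin; case/andP: (fN x).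
  - by rewrite lee_fin invr_ge0 ltW.
have aS := intM u S a mu uN S0 aU.
have bT := intM v T b mv vN T0 bV.
have amgm : ((k^-1 * (a `^ t * b `^ (1 - t)))%:E <=
    \int[lebesgue_measure]_x fw x)%E.
  apply: le_trans le_int.
  apply: (@le_trans _ _ (t * (a / S) + (1 - t) * (b / T))%:E).
    have := powR_amgm t01 (divr_gt0 a0 S0) (divr_gt0 b0 T0).
    rewrite lee_fin => amgm; apply: (le_trans _ amgm).
    have powS (c M r : R) : 0 < c -> 0 < M -> c `^ r = (c / M) `^ r * M `^ r.
      move=> c0 M0; rewrite -powRM ?(ltW M0) ?(ltW (divr_gt0 c0 M0))//.
      by rewrite divfK// gt_eqF.
    rewrite (powS a S)// (powS b T)// [X in _^-1 * X]mulrACA -/k mulrCA.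
    by rewrite mulVf ?mulr1// gt_eqF.
  rewrite EFinD !EFinM; apply: leeD; rewrite -EFinM EFinM lee_pmul2l//.
move: amgm; rewrite /fw ge0_integralZl//; last by rewrite lee_fin invr_ge0 ltW.
by rewrite EFinM lee_pmul2l// ?lte_fin ?invr_gt0.
Qed.

(** A bounded, boundedly supported approximation from below; both bounds are [n]
    so that a single monotone sequence suffices. *)
Definition box_trunc (R : realType) (n : nat) (f : R -> \bar R) (x : R) : R :=
  if `|x| <= n%:R then fine (mine (f x) n%:R%:E) else 0.

Lemma box_truncE (R : realType) n (f : R -> \bar R) x : (0 <= f x)%E ->
  `|x| <= n%:R -> (box_trunc n f x)%:E = mine (f x) n%:R%:E.
Proof.
move=> f0 xn; rewrite /box_trunc xn fineK// ge0_fin_numE.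
  by rewrite gt_min ltry orbT.
by rewrite le_min f0 lee_fin ler0n.
Qed.

Lemma box_trunc_ge0 (R : realType) n (f : R -> \bar R) x : (0 <= f x)%E ->
  0 <= box_trunc n f x <= n%:R.
Proof.
move=> f0; have [xn|xn] := boolP (`|x| <= n%:R); last first.
  by rewrite /box_trunc (negbTE xn) lexx/=.
by rewrite -!lee_fin box_truncE// le_min f0 lee_fin ler0n/= ge_min lexx orbT.
Qed.

Lemma box_trunc_le (R : realType) n (f : R -> \bar R) x : (0 <= f x)%E ->
  ((box_trunc n f x)%:E <= f x)%E.
Proof.
move=> f0; have [xn|xn] := boolP (`|x| <= n%:R); last first.
  by rewrite /box_trunc (negbTE xn).
by rewrite box_truncE// ge_min lexx.
Qed.

Lemma box_trunc_nd (R : realType) (f : R -> \bar R) x : (0 <= f x)%E ->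
  {homo (fun n => (box_trunc n f x)%:E) : m n / (m <= n)%N >-> (m <= n)%E}.
Proof.
move=> f0 m n mn; have [xm|xm] := boolP (`|x| <= m%:R).
  rewrite !box_truncE//; last by rewrite (le_trans xm)// ler_nat.
  by rewrite le_min ge_min lexx/= ge_min lee_fin ler_nat mn orbT.
rewrite {1}/box_trunc (negbTE xm) lee_fin.
by case/andP: (box_trunc_ge0 n f0).
Qed.

Lemma box_trunc_cvg (R : realType) (f : R -> \bar R) x : (0 <= f x)%E ->
  (box_trunc n f x)%:E @[n --> \oo] --> f x.
Proof.
move=> f0.
have near_box : \forall n \near \oo, `|x| <= n%:R.
  by near=> n; near: n; exact: nbhs_infty_ger.
have := f0; case fx : (f x) => [r| |]// r0.
  apply: cvg_near_cst; near=> n.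
  rewrite box_truncE//; last by near: n.
  rewrite fx min_l// lee_fin; near: n; exact: nbhs_infty_ger.
apply/cvgeyPge => A; near=> n.
rewrite box_truncE//; last by near: n.
rewrite fx min_r ?leey// lee_fin; near: n; exact: nbhs_infty_ger.
Unshelve. all: by end_near. Qed.

Lemma measurable_box_trunc (R : realType) n (f : R -> \bar R) :
  measurable_fun setT f -> measurable_fun setT (box_trunc n f).
Proof.
move=> mf; apply: measurable_fun_ifT => //.
  by apply: measurable_fun_ler => //.
apply: measurableT_comp => //; exact: measurable_mine.
Qed.

Lemma lt_integral_box_trunc (R : realType) (f : R -> \bar R) (a : R) :
  measurable_fun setT f -> (forall x, 0 <= f x)%E ->
  (a%:E < \int[lebesgue_measure]_x f x)%E ->
  \forall n \near \oo, (a%:E < \int[lebesgue_measure]_x (box_trunc n f x)%:E)%E.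
Proof.
move=> mf f0 af.
have : (\int[lebesgue_measure]_x (box_trunc n f x)%:E)%E @[n --> \oo] -->
    (\int[lebesgue_measure]_x f x)%E.
  have -> : (\int[lebesgue_measure]_x f x)%E = (\int[lebesgue_measure]_x
      limn (fun n => (box_trunc n f x)%:E))%E.
    by apply: eq_integral => x _; apply/esym/cvg_lim => //; exact: box_trunc_cvg.
  apply: cvg_monotone_convergence => //.
  - by move=> n; apply/measurable_EFinP; exact: measurable_box_trunc.
  - by move=> n x _; rewrite lee_fin; case/andP: (box_trunc_ge0 n (f0 x)).
  - by move=> x _; exact: box_trunc_nd.
move=> /(_ [set y | (a%:E < y)%E]); apply.
by apply: open_nbhs_nbhs; split => //; exact: open_ereal_gt_ereal.
Qed.

(** A strict lower bound for an integral is already one for the integral of a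
    large truncation, so the bounded case applies. *)
Lemma prekopa_leindler_1d (R : realType) (t : R) (u v w : R -> \bar R) :
  0 < t < 1 ->
  measurable_fun setT u -> measurable_fun setT v -> measurable_fun setT w ->
  (forall x, 0 <= u x)%E -> (forall x, 0 <= v x)%E -> (forall x, 0 <= w x)%E ->
  (forall x y, geomean_le t (u x) (v y) (w (t * x + (1 - t) * y))) ->
  geomean_le t (\int[lebesgue_measure]_x u x)
    (\int[lebesgue_measure]_x v x) (\int[lebesgue_measure]_x w x).
Proof.
move=> t01 mu mv mw u0 v0 w0 H a b a0 b0 aU bV.
have [n [aUn bVn]] : exists n,
    (a%:E < \int[lebesgue_measure]_x (box_trunc n u x)%:E)%E /\
    (b%:E < \int[lebesgue_measure]_x (box_trunc n v x)%:E)%E.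
  near \oo => n; exists n; split; near: n; exact: lt_integral_box_trunc.
apply: (@prekopa_leindler_bounded R t n%:R (box_trunc n u) (box_trunc n v)) => //.
- exact: measurable_box_trunc.
- exact: measurable_box_trunc.
- by move=> x; exact: box_trunc_ge0.
- by move=> x; exact: box_trunc_ge0.
- by move=> x nx; rewrite /box_trunc leNgt nx.
- by move=> x nx; rewrite /box_trunc leNgt nx.
- move=> x y a' b' a'0 b'0 a'u b'v; apply: H => //.
    exact: lt_le_trans a'u (box_trunc_le _ _).
  exact: lt_le_trans b'v (box_trunc_le _ _).
Unshelve. all: by end_near. Qed.

(** * Prekopa-Leindler in dimension n *)

(** Every open set of row vectors is a countable union of balls of rational
    centre and radius [1/(k+1)], and such a ball is a finite intersection of
    conditions on single coordinates. *)
Lemma measurable_fun_rV d (T : measurableType d) (R : realType) n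
    (F : T -> borel_rV R n) :
  (forall i, measurable_fun setT (fun x => (F x : 'rV[R]_n) 0 i)) ->
  measurable_fun setT F.
Proof.
move=> mF.
pose B (p : 'rV[rat]_n * nat) : set 'rV[R]_n :=
  ball (map_mx ratr p.1 : 'rV[R]_n) p.2.+1%:R^-1.
apply: (@measurability _ _ _ (borel_rV R n) _ _ (@open 'rV[R]_n) erefl).
move=> _ [U oU <-]; rewrite setTI.
rewrite (_ : U = \bigcup_(p in [set p | B p `<=` U]) B p); last first.
  apply/seteqP; split => [x Ux|x [p /= pU]]; last exact: pU.
  have /nbhs_ballP[e /= e0 xU] : nbhs x U by exact: open_nbhs_nbhs.
  have [k ke] : exists k, k.+1%:R^-1 < e / 2 :> R.
    have [k _ /(_ k (leqnn k))] :=
      near_infty_natSinv_lt (PosNum (divr_gt0 e0 (ltr0n _ 2))).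
    by exists k.
  have k0 : 0 < k.+1%:R^-1 :> R by rewrite invr_gt0.
  have /choice[q xq] (i : 'I_n) : exists q : rat, `|ratr q - x 0 i| < k.+1%:R^-1.
    have /rat_in_itvoo[q] : x 0 i - k.+1%:R^-1 < x 0 i + k.+1%:R^-1.
      by rewrite ltrD2l gtrN.
    by rewrite in_itv/= -ltr_distlC => qx; exists q; rewrite distrC.
  have qx : ball (map_mx ratr (\row_i q i) : 'rV[R]_n) k.+1%:R^-1 x.
    by split=> // i j; rewrite !mxE (ord1 i); exact: xq.
  exists (\row_i q i, k) => //= y qy; apply: xU; rewrite (splitr e).
  apply: (ball_triangle (ball_sym (le_ball (ltW ke) qx))).
  exact: le_ball (ltW ke) _ qy.
rewrite preimage_bigcup bigcup_mkcond.
apply: countable_bigcupT_measurable => // p.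
case: ifPn => // _.
rewrite (_ : _ @^-1` _ = \bigcap_(i in [set: 'I_n])
    [set x | `|(map_mx ratr p.1 : 'rV[R]_n) 0 i - (F x : 'rV[R]_n) 0 i|
             < p.2.+1%:R^-1]); last first.
  apply/seteqP; split => x /=; first by move=> [_ H] i _; exact: H.
  by move=> H; split; [rewrite invr_gt0|move=> i j; rewrite (ord1 i); exact: H].
apply: fin_bigcap_measurable => // i _.
rewrite -[X in measurable X]setTI.
suff : measurable_fun setT (fun x => `|(map_mx ratr p.1 : 'rV[R]_n) 0 i -
    (F x : 'rV[R]_n) 0 i| < p.2.+1%:R^-1) by move=> /(_ measurableT [set true]); exact.
apply: measurable_fun_ltr => //.
apply: measurableT_comp => //.
exact: measurable_funB.
Qed.

Definition row_cons (R : realType) n (p : measurableTypeR R * borel_rV R n) :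
  borel_rV R n.+1 :=
  row_mx (p.1%:M : 'rV[R]_1) (p.2 : 'rV[R]_n) : 'rV[R]_(1 + n).

Lemma measurable_row_cons (R : realType) n :
  measurable_fun setT (@row_cons R n).
Proof.
apply: measurable_fun_rV => i; rewrite /row_cons.
case: (splitP (i : 'I_(1 + n))) => j ij.
  have -> : i = lshift n j by exact/val_inj.
  under eq_fun do rewrite (@row_mxEl _ 1 1 n) (ord1 j) mxE mulr1n.
  exact: measurable_fst.
have -> : i = rshift 1 j by exact/val_inj.
under eq_fun do rewrite (@row_mxEr _ 1 1 n).
apply: (measurableT_comp (f := fun y : borel_rV R n => (y : 'rV[R]_n) 0 j)) => //.
apply: continuous_measurable_rV1; exact: coord_continuous.
Qed.

(** Tonelli's theorem for the recursive definition of Lebesgue measure, which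
    exhibits it as the image of a product measure. *)
Lemma integral_lebesgue_rVS (R : realType) n (f : borel_rV R n.+1 -> \bar R) :
  measurable_fun setT f -> (forall x, 0 <= f x)%E ->
  (\int[lebesgue_rV]_x f x =
   \int[lebesgue_measure]_t \int[lebesgue_rV]_y f (row_cons (t, y)))%E.
Proof.
move=> mf f0.
pose lm : {measure set (measurableTypeR R * borel_rV R n)%type -> \bar R} :=
  (lebesgue_measure \x lebesgue_rV)%E.
pose pm : {measure set (borel_rV R n.+1) -> \bar R} :=
  measure_function.measure_function_pushforward__canonical__measure_function_Measure
    lm (@measurable_row_cons R n).
transitivity (\int[pm]_x f x)%E.
  apply: eq_measure_integral => A mA _ /=.
  apply: eq_integral => t _ /=; congr (lebesgue_rV _).
  by apply/seteqP; split => y /=; rewrite /xsection/= inE.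
rewrite ge0_integral_pushforward//; last exact: measurable_row_cons.
rewrite preimage_setT fubini_tonelli1//; last by move=> p; exact: f0.
exact: measurableT_comp mf (@measurable_row_cons R n).
Qed.

(** For fixed first coordinates the slices satisfy the hypothesis in dimension
    [n], hence their integrals satisfy it on the line. *)
Lemma prekopa_leindler (R : realType) (t : R) n
    (u v w : borel_rV R n -> \bar R) : 0 < t < 1 ->
  measurable_fun setT u -> measurable_fun setT v -> measurable_fun setT w ->
  (forall x, 0 <= u x)%E -> (forall x, 0 <= v x)%E -> (forall x, 0 <= w x)%E ->
  (forall x y : 'rV[R]_n,
     geomean_le t (u x) (v y) (w (t *: x + (1 - t) *: y : 'rV[R]_n))) ->
  geomean_le t (\int[lebesgue_rV]_x u x)
    (\int[lebesgue_rV]_x v x) (\int[lebesgue_rV]_x w x).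
Proof.
move=> t01; elim: n u v w => [|n IH] u v w mu mv mw u0 v0 w0 H.
  have dirac0 (f : borel_rV R 0 -> \bar R) : measurable_fun setT f ->
      (\int[lebesgue_rV]_x f x = f (0%R : 'rV[R]_0))%E.
    by move=> mf; rewrite integral_dirac// diracT mul1e.
  rewrite !dirac0//; have := H (0 : 'rV[R]_0) (0 : 'rV[R]_0).
  by rewrite !scaler0 addr0.
rewrite !integral_lebesgue_rVS//.
have msec (f : borel_rV R n.+1 -> \bar R) : measurable_fun setT f ->
    measurable_fun setT (f \o @row_cons R n).
  by move=> mf; exact: measurableT_comp mf (@measurable_row_cons R n).
have msec1 (f : borel_rV R n.+1 -> \bar R) (s : R) : measurable_fun setT f ->
    measurable_fun setT (fun y : borel_rV R n => f (row_cons (s, y))).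
  by move=> mf; exact: measurableT_comp (msec f mf) (measurable_pair1 _).
have mint (f : borel_rV R n.+1 -> \bar R) : measurable_fun setT f ->
    (forall x, 0 <= f x)%E ->
    measurable_fun setT
      (fun s : R => \int[lebesgue_rV]_y f (row_cons (s, y)))%E.
  move=> mf f0; have mfc := msec f mf.
  by apply: (measurable_fun_fubini_tonelli_F (m2 := @lebesgue_rV R n) _ mfc) => p; exact: f0.
apply: (@prekopa_leindler_1d R t
  (fun r => \int[lebesgue_rV]_y u (row_cons (r, y)))%E
  (fun r => \int[lebesgue_rV]_y v (row_cons (r, y)))%E
  (fun r => \int[lebesgue_rV]_y w (row_cons (r, y)))%E) => //; try exact: mint.
1-3: by move=> s; apply: integral_ge0.
move=> r s; apply: IH => //; try exact: msec1.
move=> x y; suff <- : t *: row_cons (r, x) + (1 - t) *: row_cons (s, y) =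
  row_cons (t * r + (1 - t) * s, t *: x + (1 - t) *: y) by exact: H.
rewrite /row_cons/= !(@scale_row_mx _ 1 1 n) (@add_row_mx _ 1 1 n).
by rewrite !scale_scalar_mx -raddfD.
Qed.

(** * Densities, derivatives along lines and strong convexity *)

(** The density [g] agrees almost everywhere with the Radon-Nikodym derivative,
    for which the change of variables is known. *)
Lemma ge0_integral_density d (T : measurableType d) (R : realType)
    (mu : {sigma_finite_measure set T -> \bar R}) (nu : probability T R)
    (g : T -> R) (f : T -> \bar R) :
  measurable_fun setT g ->
  (forall A, measurable A -> nu A = \int[mu]_(x in A) (g x)%:E)%E ->
  measurable_fun setT f -> (forall x, 0 <= f x)%E ->
  (\int[nu]_x f x = \int[mu]_x (f x * (g x)%:E))%E.
Proof.
move=> mg nug mf f0.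
have numu : nu `<< mu.
  apply/null_content_dominatesP => A mA muA0.
  rewrite nug//; apply: null_set_integral => //.
  exact/measurable_EFinP/measurable_funTS.
rewrite -(Radon_Nikodym_SigmaFinite.change_of_variables numu f0 measurableT mf).
have int_RN := Radon_Nikodym_SigmaFinite.f_integrable numu.
have mRN := measurable_int _ int_RN.
apply: ae_eq_integral => //.
- exact: emeasurable_funM.
- by apply: emeasurable_funM => //; exact/measurable_EFinP.
- apply: ae_eqe_mul2l; apply: integral_ae_eq => //.
    exact/measurable_EFinP.
  move=> A _ mA; rewrite -nug//.
  by rewrite -(Radon_Nikodym_SigmaFinite.f_integral numu).
Qed.

Lemma second_derivative_chord (R : realType) (q q' q'' : R -> R) (t : R) :
  (forall x : R, is_derive x (1 : R) q (q' x)) ->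
  (forall x : R, is_derive x (1 : R) q' (q'' x)) ->
  (forall x, 0 <= q'' x) -> 0 < t < 1 -> q t <= t * q 1 + (1 - t) * q 0.
Proof.
move=> dq dq' q''0 /andP[t0 t1].
have cq : continuous q.
  by move=> x; apply/differentiable_continuous/derivable1_diffP; exact: ex_derive.
have Dq : 'D_(1 : R) q = q' by apply/funext => x; exact: derive_val.
have t01 : 0 <= 1 - t <= 1 by lra.
pose i : {i01 R} := Itv01 (proj1 (andP t01)) (proj2 (andP t01)).
suff : q ((1 - t) * 0 + (1 - (1 - t)) * 1) <=
    (1 - t) * q 0 + (1 - (1 - t)) * q 1.
  by rewrite mulr0 add0r mulr1 subKr [leRHS]addrC.
apply: (@second_derivative_convex R q 0 1 _ _ _ _ _ i ler01).
- by move=> x _; rewrite Dq (_ : 'D_1 q' x = q'' x) ?q''0//; exact: derive_val.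
- by apply: cvg_at_left_filter; exact: cq.
- by apply: cvg_at_right_filter; exact: cq.
- by move=> x _; exact: ex_derive.
- by move=> x _; rewrite Dq; exact: ex_derive.
Qed.

Section directional.
Context {R : realType} {n : nat}.
Implicit Types (f : 'rV[R]_n -> R) (x w : 'rV[R]_n).

Lemma derive_partial f x w : differentiable f x ->
  'D_w f x = \sum_(i < n) w 0 i * partial i f x.
Proof.
move=> df; rewrite deriveE// {1}(row_sum_delta w) linear_sum.
by apply: eq_bigr => i _; rewrite linearZ/= /partial deriveE.
Qed.

Lemma is_derive_line f x w (s : R) : differentiable f (x + s *: w) ->
  is_derive s 1 (fun r => f (x + r *: w))
    (\sum_(i < n) w 0 i * partial i f (x + s *: w)).
Proof.
move=> df; rewrite -derive_partial//.
have E : (fun h : R => h^-1 *: (((fun r => f (x + r *: w)) \o shift s) (h *: 1)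
          - f (x + s *: w))) =
    (fun h : R => h^-1 *: ((f \o shift (x + s *: w)) (h *: w) - f (x + s *: w))).
  apply/funext => h /=; congr (_ *: (f _ - _)).
  by rewrite scalerDl addrCA /GRing.scale/= mulr1.
have dw : derivable f (x + s *: w) w by exact: diff_derivable.
apply: DeriveDef; first by rewrite /derivable E.
by rewrite /derive E.
Qed.

Lemma differentiable_partial f x i : differentiable (gradient f) x ->
  differentiable (partial i f) x.
Proof.
move=> df; rewrite (_ : partial i f = (fun y => y 0 i) \o gradient f).
  apply: (@differentiable_comp _ _ _ _ (gradient f) (fun y : 'rV[R]_n => y 0 i)) => //.
  exact: (@differentiable_coord _ 1 n _ 0 i).
by apply/funext => y; rewrite /= mxE.
Qed.

Lemma is_derive2_line f x w (s : R) : differentiable (gradient f) (x + s *: w) ->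
  is_derive s 1 (fun r => \sum_(i < n) w 0 i * partial i f (x + r *: w))
    (quadform (hessian f (x + s *: w)) w).
Proof.
move=> df.
have -> : quadform (hessian f (x + s *: w)) w = \sum_(i < n)
    w 0 i * (\sum_(j < n) w 0 j * partial j (partial i f) (x + s *: w)).
  rewrite /quadform mxE; apply: eq_bigr => i _; rewrite !mxE mulrC.
  by congr (_ * _); apply: eq_bigr => j _; rewrite !mxE.
rewrite (_ : (fun r => _) = \sum_(i < n)
    (fun r => w 0 i *: partial i f (x + r *: w))); last first.
  by apply/funext => r; rewrite fct_sumE.
apply: is_derive_sum => i.
apply: is_deriveZ.
apply: is_derive_line; exact: differentiable_partial.
Qed.

End directional.

Section euclid.
Context {R : realType} {n : nat}.
Implicit Types (p w x y : 'rV[R]_n).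

Lemma sqr_norm2 w : norm2 w ^+ 2 = \sum_(i < n) w 0 i ^+ 2.
Proof. by rewrite sqr_sqrtr// sumr_ge0// => i _; rewrite sqr_ge0. Qed.

Lemma norm2_ge0 w : 0 <= norm2 w. Proof. exact: sqrtr_ge0. Qed.

Lemma norm2Z (k : R) w : norm2 (k *: w) = `|k| * norm2 w.
Proof.
rewrite -(sqrtr_sqr k) -sqrtrM ?sqr_ge0//; congr Num.sqrt.
by rewrite mulr_sumr; apply: eq_bigr => i _; rewrite mxE exprMn.
Qed.

(** Nonnegativity of [|p - l w|^2] at the minimising [l]. *)
Lemma cauchy_schwarz p w : \sum_(i < n) p 0 i * w 0 i <= norm2 p * norm2 w.
Proof.
rewrite /norm2 -sqrtrM; last by rewrite sumr_ge0// => i _; rewrite sqr_ge0.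
rewrite (le_trans (ler_norm _))// -sqrtr_sqr ler_wsqrtr//.
set C := \sum_(i < n) w 0 i ^+ 2; set B := \sum_(i < n) p 0 i * w 0 i.
set A := \sum_(i < n) p 0 i ^+ 2.
have C0 : 0 <= C by rewrite sumr_ge0// => i _; rewrite sqr_ge0.
have quad (l : R) : 0 <= A - 2 * l * B + l ^+ 2 * C.
  rewrite (_ : _ + _ = \sum_(i < n) (p 0 i - l * w 0 i) ^+ 2).
    by rewrite sumr_ge0// => i _; rewrite sqr_ge0.
  rewrite /A /B /C !mulr_sumr -sumrB -big_split/=; apply: eq_bigr => i _; ring.
have [C_eq0|C_neq0] := eqVneq C 0.
  have w0 i : w 0 i = 0.
    move/eqP : C_eq0; rewrite psumr_eq0 => [|j _]; last exact: sqr_ge0.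
    by move=> /allP/(_ i (mem_index_enum _)); rewrite sqrf_eq0 => /eqP.
  rewrite (_ : B = 0) ?expr0n ?mulr_ge0//=.
    by rewrite /A sumr_ge0// => i _; rewrite sqr_ge0.
  by rewrite /B big1// => i _; rewrite w0 mulr0.
have Cgt0 : 0 < C by rewrite lt_neqAle eq_sym C_neq0.
have := quad (B / C).
rewrite (_ : _ + _ = (A * C - B ^+ 2) / C); last by field.
by rewrite pmulr_lge0 ?invr_gt0// subr_ge0.
Qed.

Lemma quadform_scalar (c : R) w : quadform c%:M w = c * norm2 w ^+ 2.
Proof.
rewrite /quadform mul_mx_scalar -scalemxAl mxE mxE sqr_norm2; congr (_ * _).
by apply: eq_bigr => i _; rewrite mxE expr2.
Qed.

(** Along the segment from [y] to [x], subtracting [c/2 |x - y|^2 s^2] from [V]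
    leaves a function of [s] with nonnegative second derivative. *)
Lemma strongly_convex (V : 'rV[R]_n -> R) (c t : R) x y :
  twice_differentiable V -> (forall x, mx_le c%:M (hessian V x)) ->
  0 < t < 1 ->
  V (t *: x + (1 - t) *: y) <=
  t * V x + (1 - t) * V y - c / 2 * (t * (1 - t)) * norm2 (x - y) ^+ 2.
Proof.
move=> [dV dgV] hV t01.
set w := x - y; set N := norm2 w ^+ 2.
pose q (s : R) : R := V (y + s *: w) - c / 2 * N * s ^+ 2.
pose q' (s : R) : R := \sum_(i < n) w 0 i * partial i V (y + s *: w) - c * N * s.
pose q'' (s : R) : R := quadform (hessian V (y + s *: w)) w - c * N.
have := @second_derivative_chord _ q q' q'' t _ _ _ t01.
rewrite /q (_ : y + t *: w = t *: x + (1 - t) *: y); last first.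
  by apply/rowP => i; rewrite !mxE; ring.
rewrite (_ : y + 1 *: w = x); last by rewrite scale1r /w addrC subrK.
rewrite scale0r addr0 => H.
suff : V (t *: x + (1 - t) *: y) - c / 2 * N * t ^+ 2 <=
       t * (V x - c / 2 * N * 1 ^+ 2) + (1 - t) * (V y - c / 2 * N * 0 ^+ 2).
  rewrite expr1n expr0n/= mulr0; lra.
apply: H => s.
- apply: is_deriveB; first exact: is_derive_line.
  by apply: is_derive_eq; rewrite /GRing.scale/=; field.
- apply: is_deriveB; first exact: is_derive2_line.
  by apply: is_derive_eq; rewrite /GRing.scale/= mulr1.
- by rewrite /q'' subr_ge0 -quadform_scalar; exact: hV.
Qed.

End euclid.

(** * The logarithmic Sobolev inequality for bounded functions *)

(** The strict bounds in [geomean_le] are removed by scaling both numbers by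
    [l < 1], which scales the geometric mean by [l]. *)
Lemma geomean_le_powR (R : realType) (t p q : R) (r : \bar R) : 0 < p -> 0 < q ->
  geomean_le t p%:E q%:E r -> ((p `^ t * q `^ (1 - t))%:E <= r)%E.
Proof.
move=> p0 q0 H; apply/lee_mul01Pr.
  by rewrite lee_fin mulr_ge0// powR_ge0.
move=> l /andP[l0 l1]; rewrite -EFinM.
have := H (l * p) (l * q); rewrite !mulr_gt0// !lte_fin !gtr_pMl//.
move=> /(_ isT isT l1 l1); congr (_ <= _)%E; congr (_%:E).
rewrite (powRM _ (ltW l0) (ltW p0)) (powRM _ (ltW l0) (ltW q0)) mulrACA.
rewrite -powRD; last by rewrite (gt_eqF l0) implybT.
by rewrite addrC subrK (powRr1 (ltW l0)).
Qed.

(** The derivative at [t = 1] of the dual inequality, phrased as a limit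
    [s -> 0] with [s = 1 - t]. *)
Lemma entropy_limit (R : realType) (A B K L c s0 : R) :
  0 < A -> 0 < c -> 0 < s0 ->
  (forall s, 0 < s < s0 -> A * B / (A + s / (1 - s) * B) - A * ln A <=
     expR (s * L) / (2 * c * (1 - s)) * K) ->
  B - A * ln A <= K / (2 * c).
Proof.
move=> A0 c0 s00 H.
have c1s : (1 - s : R) @[s --> 0] --> (1 - 0 : R).
  by apply: cvgB => //; exact: cvg_cst.
have cl : A * B / (A + s / (1 - s) * B) - A * ln A @[s --> 0^'+] -->
    A * B / (A + 0 / (1 - 0) * B) - A * ln A.
  apply: cvg_at_right_filter; apply: cvgB; last exact: cvg_cst.
  apply: cvgM; first exact: cvg_cst.
  apply: cvgV; first by rewrite mul0r mul0r addr0 gt_eqF.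
  apply: cvgD; first exact: cvg_cst.
  apply: cvgM; last exact: cvg_cst.
  apply: cvgM => //; apply: cvgV => //; by rewrite subr0 oner_neq0.
have cr : expR (s * L) / (2 * c * (1 - s)) * K @[s --> 0^'+] -->
    expR (0 * L) / (2 * c * (1 - 0)) * K.
  apply: cvg_at_right_filter; apply: cvgM; last exact: cvg_cst.
  apply: cvgM.
    apply: (@cvg_comp _ _ _ (fun s : R => s * L) expR _ (nbhs (0 * L))).
      by apply: cvgM => //; exact: cvg_cst.
    exact: continuous_expR.
  apply: cvgV; first by rewrite subr0 mulr1 mulf_neq0// gt_eqF.
  by apply: cvgM => //; exact: cvg_cst.
have El : A * B / (A + 0 / (1 - 0) * B) = B.
  by rewrite !mul0r addr0 mulrAC divff ?mul1r// gt_eqF.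
have Er : expR (0 * L) / (2 * c * (1 - 0)) * K = K / (2 * c).
  by rewrite mul0r expR0 subr0 mulr1 mul1r mulrC.
rewrite El in cl; rewrite Er in cr; apply: ler_cvg_to cl cr _.
near=> s; apply: H; apply/andP; split; near: s.
  exact: nbhs_right_gt.
exact: nbhs_right_lt.
Unshelve. all: by end_near. Qed.

Section strongly_log_concave.
Context {R : realType} {n : nat}.
Variables (nu : probability (borel_rV R n) R) (V : 'rV[R]_n -> R) (c : R).
Hypothesis nuV : forall A : set (borel_rV R n), measurable A ->
  nu A = (\int[lebesgue_rV]_(x in A) (expR (- V x))%:E)%E.
Hypothesis mV : measurable_fun setT (V : borel_rV R n -> R).
Hypothesis convV : forall t (x y : 'rV[R]_n), 0 < t < 1 ->
  V (t *: x + (1 - t) *: y) <=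
  t * V x + (1 - t) * V y - c / 2 * (t * (1 - t)) * norm2 (x - y) ^+ 2.

Let mexpV : measurable_fun setT ((fun x => expR (- V x)) : borel_rV R n -> R).
Proof. by apply: measurableT_comp => //; exact: measurable_funN. Qed.

Lemma integral_expR_density (f : borel_rV R n -> R) : measurable_fun setT f ->
  (\int[nu]_x (expR (f x))%:E = \int[lebesgue_rV]_x (expR (f x - V x))%:E)%E.
Proof.
move=> mf; rewrite (ge0_integral_density mexpV nuV).
- by apply: eq_integral => x _; rewrite -EFinM expRD.
- by apply/measurable_EFinP; exact: measurableT_comp.
- by move=> x; rewrite lee_fin expR_ge0.
Qed.

(** With [z = t x + (1 - t) y] one has [x - z = (1 - t) (x - y)], which turns the
    convexity defect [c/2 t (1 - t) |x - y|^2] of [V] into the quadratic cost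
    [c t / (2 (1 - t)) |x - z|^2]. *)
Lemma prekopa_leindler_dual (t : R) (psi chi : borel_rV R n -> R) :
  0 < t < 1 -> measurable_fun setT psi -> measurable_fun setT chi ->
  (forall x z : 'rV[R]_n,
     psi x - c * t / (2 * (1 - t)) * norm2 (x - z) ^+ 2 <= chi z) ->
  geomean_le t (\int[nu]_x (expR (psi x / t))%:E) 1
    (\int[nu]_x (expR (chi x))%:E).
Proof.
move=> t01 mpsi mchi H; have /andP[t0 t1] := t01.
have s0 : 0 < 1 - t by rewrite subr_gt0.
have mpsit : measurable_fun setT (fun x => psi x / t) by exact: measurable_funM.
have -> : (1%E : \bar R) = (\int[nu]_x (expR (0 : R))%:E)%E.
  by rewrite expR0 integral_cst//= mul1e; apply/esym; exact: probability_setT.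
rewrite !integral_expR_density//.
have mexp (f : borel_rV R n -> R) : measurable_fun setT f ->
    measurable_fun setT (fun x => (expR (f x - V x))%:E).
  move=> mf; apply/measurable_EFinP; apply: measurableT_comp => //.
  exact: measurable_funB.
apply: prekopa_leindler => //; try exact: mexp.
move=> x y a b a0 b0; rewrite !lte_fin lee_fin => au bv.
apply: (@le_trans _ _ (expR (psi x / t - V x) `^ t * expR (0 - V y) `^ (1 - t))).
  apply: ler_pM; try exact: powR_ge0.
    by apply: ge0_ler_powR; rewrite ?nnegrE ?expR_ge0// ltW.
  by apply: ge0_ler_powR; rewrite ?nnegrE ?expR_ge0// ltW.
rewrite -!expRM -expRD ler_expR.
set z := t *: x + (1 - t) *: y.
have := H x z; have -> : x - z = (1 - t) *: (x - y).
  by apply/rowP => i; rewrite !mxE; ring.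
rewrite norm2Z exprMn real_normK ?num_real//.
have := convV x y t01; rewrite -/z.
set N := norm2 (x - y) ^+ 2.
have -> : c * t / (2 * (1 - t)) * ((1 - t) ^+ 2 * N) = c / 2 * (t * (1 - t)) * N.
  by field; rewrite gt_eqF.
have -> : (psi x / t - V x) * t = psi x - t * V x by field; rewrite gt_eqF.
lra.
Qed.

End strongly_log_concave.

Lemma bounded_integrable d (T : measurableType d) (R : realType)
    (P : probability T R) (f : T -> R) (C : R) :
  measurable_fun setT f -> (forall x, `|f x| <= C) ->
  P.-integrable setT (EFin \o f).
Proof.
move=> mf fC; apply: measurable_bounded_integrable => //.
  by rewrite (le_lt_trans (probability_le1 P measurableT))// ltry.
exists C; split; first exact: num_real.
by move=> y Cy x _; apply: le_trans (fC x) (ltW Cy).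
Qed.

Section bounded_log_sobolev.
Context {R : realType} {n : nat}.
Variables (nu : probability (borel_rV R n) R) (V : 'rV[R]_n -> R) (c : R).
Hypothesis nuV : forall A : set (borel_rV R n), measurable A ->
  nu A = (\int[lebesgue_rV]_(x in A) (expR (- V x))%:E)%E.
Hypothesis mV : measurable_fun setT (V : borel_rV R n -> R).
Hypothesis c0 : 0 < c.
Hypothesis convV : forall t (x y : 'rV[R]_n), 0 < t < 1 ->
  V (t *: x + (1 - t) *: y) <=
  t * V x + (1 - t) * V y - c / 2 * (t * (1 - t)) * norm2 (x - y) ^+ 2.
Variables (psi slope : borel_rV R n -> R) (M : R).
Hypothesis mpsi : measurable_fun setT psi.
Hypothesis mslope : measurable_fun setT slope.
Hypothesis psiM : forall x, `|psi x| <= M.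
Hypothesis slopeM : forall x, 0 <= slope x <= M.
Hypothesis psi_slope : forall e, 0 < e -> exists2 d, 0 < d &
  forall x z : 'rV[R]_n, norm2 (x - z) <= d ->
    psi x <= psi z + (slope z + e) * norm2 (x - z).

Let A := \int[nu]_x expR (psi x).
Let B := \int[nu]_x (expR (psi x) * psi x).
Let K := \int[nu]_x (expR (psi x) * slope x ^+ 2).

Let M0 : 0 <= M. Proof. exact: le_trans (psiM (0 : 'rV[R]_n)). Qed.

Let mexp (f : borel_rV R n -> R) : measurable_fun setT f ->
  measurable_fun setT (fun x => expR (f x)).
Proof. exact: measurableT_comp. Qed.

Let iexp (f : borel_rV R n -> R) C : measurable_fun setT f ->
  (forall x, f x <= C) -> nu.-integrable setT (EFin \o (fun x => expR (f x))).
Proof.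
move=> mf fC; apply: (@bounded_integrable _ _ _ _ _ (expR C)); first exact: mexp.
by move=> x; rewrite ger0_norm ?expR_ge0// ler_expR.
Qed.

Let psi_le x : psi x <= M. Proof. exact: le_trans (ler_norm _) (psiM x). Qed.

Let iA : nu.-integrable setT (EFin \o (fun x => expR (psi x))).
Proof. exact: iexp psi_le. Qed.

Let iB : nu.-integrable setT (EFin \o (fun x => expR (psi x) * psi x)).
Proof.
apply: (@bounded_integrable _ _ _ _ _ (expR M * M)).
  by apply: measurable_funM => //; exact: mexp.
move=> x; rewrite normrM ger0_norm ?expR_ge0// ler_pM ?expR_ge0//.
by rewrite ler_expR.
Qed.

Let iK : nu.-integrable setT (EFin \o (fun x => expR (psi x) * slope x ^+ 2)).
Proof.
apply: (@bounded_integrable _ _ _ _ _ (expR M * M ^+ 2)).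
  apply: measurable_funM => //; first exact: mexp.
  exact: measurable_funX.
move=> x; rewrite normrM ger0_norm ?expR_ge0// ler_pM ?expR_ge0//.
  by rewrite ler_expR.
have /andP[sx0 sxM] := slopeM x.
by rewrite normrX ger0_norm// lerXn2r ?nnegrE.
Qed.

Let Rint_cst (r : R) : \int[nu]_(x in [set: borel_rV R n]) r = r.
Proof.
rewrite Rintegral_cst// -[RHS]mulr1; congr (_ * _).
by rewrite -[RHS]/(fine 1%E); congr fine; exact: probability_setT.
Qed.

Let A_gt0 : 0 < A.
Proof.
apply: lt_le_trans (expR_gt0 (- M)) _; rewrite -[leLHS]Rint_cst.
apply: le_Rintegral => //.
  by apply: (iexp (C := - M)) => //; exact: measurable_cst.
by move=> x _; rewrite ler_expR lerNl (le_trans _ (psiM x))// -normrN ler_norm.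
Qed.

Let B_ge : - (M * A) <= B.
Proof.
rewrite -mulNr /A -RintegralZl//; apply: le_Rintegral => //.
  exact: (integrableZl measurableT _ iA).
move=> x _; rewrite mulrC ler_pM2l ?expR_gt0//.
by rewrite lerNl (le_trans _ (psiM x))// -normrN ler_norm.
Qed.

(** The dual inequality for [t = 1 - s], with all error terms explicit.  Here
    [chi = psi + s (slope + e)^2 / (2 c t)] is above the sup-convolution of [psi]:
    for [|x - z| <= d] because [m r <= (c t / (2 s)) r^2 + s m^2 / (2 c t)], and for
    [|x - z| > d] because [s] is so small that the cost exceeds the oscillation
    of [psi]. *)
Lemma log_sobolev_step (e s d : R) : 0 < e <= 1 -> 0 < d ->
  (forall x z : 'rV[R]_n, norm2 (x - z) <= d ->
    psi x <= psi z + (slope z + e) * norm2 (x - z)) ->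
  0 < s -> s <= 1 / 2 -> s * (2 * (M + 1)) <= 1 ->
  s * (8 * (M + 1)) <= c * d ^+ 2 ->
  A * B / (A + s / (1 - s) * B) - A * ln A <=
  expR (s * ((M + 1) ^+ 2 / c)) / (2 * c * (1 - s)) *
  (K + e * ((2 * M + 1) * A)).
Proof.
move=> /andP[e0 e1] d0 Hd s0 s12 sM sd.
set t := 1 - s; set L := (M + 1) ^+ 2 / c; set E := expR (s * L).
have t0 : 0 < t by rewrite /t; lra.
have t12 : 1 <= 2 * t by rewrite /t; lra.
have t01 : 0 < t < 1 by apply/andP; split; rewrite /t; lra.
have ct0 : 0 < 2 * c * t by rewrite !mulr_gt0.
pose G x := (slope x + e) ^+ 2 / (2 * c * t).
have mG : measurable_fun setT G.
  apply: measurable_funM => //; apply: measurable_funX.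
  exact: measurable_funD.
have G0 x : 0 <= G x by rewrite divr_ge0 ?sqr_ge0// ltW.
have GL x : G x <= L.
  rewrite /G ler_pdivrMr// /L mulrAC -mulrA.
  rewrite (_ : _ / c = (2 * t)); last by field; rewrite gt_eqF.
  have /andP[sx0 sxM] := slopeM x.
  rewrite -[leLHS]mulr1 ler_pM ?sqr_ge0//.
  by rewrite lerXn2r ?nnegrE; lra.
pose chi x := psi x + s * G x.
have mchi : measurable_fun setT chi.
  by apply: measurable_funD => //; exact: measurable_funM.
have chi_le x : chi x <= M + s * L by rewrite lerD// ler_pM2l.
have ichi := iexp mchi chi_le.
have mpsit : measurable_fun setT (fun x => psi x / t) by exact: measurable_funM.
have ipsit : nu.-integrable setT (EFin \o (fun x => expR (psi x / t))).
  apply: (iexp (C := M / t)) => // x; rewrite ler_pM2r ?invr_gt0//.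
have HJ (x z : 'rV[R]_n) :
    psi x - c * t / (2 * (1 - t)) * norm2 (x - z) ^+ 2 <= chi z.
  rewrite /chi (_ : 1 - t = s); last by rewrite /t; ring.
  set r := norm2 (x - z).
  have [rd|rd] := leP r d.
    have m2 : (slope z + e) * r <= c * t / (2 * s) * r ^+ 2 + s * G z.
      rewrite -subr_ge0 (_ : _ - _ =
          (c * t * r - s * (slope z + e)) ^+ 2 / (2 * c * t * s)); last first.
        by rewrite /G; field; rewrite !gt_eqF.
      by rewrite divr_ge0 ?sqr_ge0// ltW// mulr_gt0.
    by have := Hd x z rd; rewrite -/r; lra.
  have big : 2 * M <= c * t / (2 * s) * r ^+ 2.
    rewrite mulrAC ler_pdivlMr ?mulr_gt0//.
    have dr : d ^+ 2 <= r ^+ 2 by rewrite lerXn2r ?nnegrE ?ltW// (lt_trans d0).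
    have h1 : c * d ^+ 2 <= c * r ^+ 2 by rewrite ler_pM2l.
    have h2 : c * r ^+ 2 <= 2 * t * (c * r ^+ 2).
      by rewrite ler_peMl// mulr_ge0 ?sqr_ge0// ltW.
    have h3 : 0 <= M * s by rewrite mulr_ge0// ltW.
    nra.
  have := psi_le x; have : - M <= psi z.
    by rewrite lerNl (le_trans _ (psiM z))// -normrN ler_norm.
  have := mulr_ge0 (ltW s0) (G0 z).
  lra.
pose At := \int[nu]_x expR (psi x / t).
pose W := \int[nu]_x expR (chi x).
pose Y := A + s / t * B.
have AtY : Y <= At.
  rewrite /Y /A /B -RintegralZl// -RintegralD//; last first.
    exact: (integrableZl measurableT _ iB).
  apply: le_Rintegral => //.
    exact: (integrableD measurableT iA (integrableZl measurableT (s / t) iB)).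
  move=> x _; have -> : psi x / t = psi x + s / t * psi x.
    by rewrite /t; field; rewrite gt_eqF.
  rewrite expRD mulrCA -{1}[expR (psi x)]mulr1 -mulrDr ler_pM2l ?expR_gt0//.
  exact: expR_ge1Dx.
have st : s / t <= 2 * s.
  by rewrite ler_pdivrMr// mulrAC ler_peMl// ltW.
have Y0 : 0 < Y.
  have h1 : s / t * (M * A) <= 2 * s * (M * A).
    by rewrite ler_wpM2r// mulr_ge0// ltW.
  have h2 : - (s / t * (M * A)) <= s / t * B.
    by rewrite -mulrN ler_pM2l// divr_gt0.
  have h3 : 0 < s * A by rewrite mulr_gt0.
  have h4 : s * (2 * (M + 1)) * A <= A by rewrite ler_piMl// ltW.
  rewrite /Y; nra.
have At0 : 0 < At by exact: lt_le_trans AtY.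
pose k := s * E / (2 * c * t).
have k0 : 0 <= k.
  by rewrite /k ltW// mulr_gt0 ?invr_gt0// mulr_gt0// expR_gt0.
have WA : W <= A + k * (K + e * ((2 * M + 1) * A)).
  have iKA := integrableD measurableT iK
    (integrableZl measurableT (e * (2 * M + 1)) iA).
  rewrite mulrA /A /K -RintegralZl// -RintegralD//; last first.
    exact: (integrableZl measurableT (e * (2 * M + 1)) iA).
  rewrite -RintegralZl// -RintegralD//; last first.
    exact: (integrableZl measurableT k iKA).
  apply: le_Rintegral => //.
    exact: (integrableD measurableT iA (integrableZl measurableT k iKA)).
  move=> x _; rewrite /chi expRD.
  rewrite [leRHS](_ : _ = expR (psi x) *
      (1 + k * (slope x ^+ 2 + e * (2 * M + 1)))); last by rewrite /=; ring.
  rewrite ler_pM2l ?expR_gt0//.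
  have sGE : expR (s * G x) <= 1 + s * G x * expR (s * G x).
    have := expR_ge1Dx (- (s * G x)).
    rewrite -(ler_pM2r (expR_gt0 (s * G x))) -expRD addNr expR0.
    lra.
  apply: le_trans sGE _; rewrite lerD2l.
  apply: (@le_trans _ _ (s * G x * E)).
    apply: ler_wpM2l; first by rewrite mulr_ge0 ?(ltW s0).
    by rewrite ler_expR ler_wpM2l ?(ltW s0).
  have -> : s * G x * E = k * (slope x + e) ^+ 2 by rewrite /k /G; field; rewrite !gt_eqF.
  rewrite ler_wpM2l//.
  have /andP[sx0 sxM] := slopeM x.
  have := ler_pM (ltW e0) sx0 e1 sxM.
  nra.
have AtW : At `^ t <= W.
  have EAt : (\int[nu]_x (expR (psi x / t))%:E)%E = At%:E.
    by rewrite /At /Rintegral fineK//; exact: integrable_fin_num.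
  have EW : (\int[nu]_x (expR (chi x))%:E)%E = W%:E.
    by rewrite /W /Rintegral fineK//; exact: integrable_fin_num.
  have := prekopa_leindler_dual nuV mV convV t01 mpsi mchi HJ.
  rewrite EAt EW => /(geomean_le_powR At0 ltr01).
  by rewrite powR1 mulr1 lee_fin.
have W0 : 0 < W by apply: lt_le_trans AtW; rewrite powR_gt0.
have lnle (p q : R) : 0 < p -> 0 < q -> ln p <= ln q + (p / q - 1).
  move=> p0 q0; have pq : 0 < p / q by rewrite divr_gt0.
  have /le_ln1Dx : -1 < p / q - 1 by lra.
  rewrite (_ : 1 + (p / q - 1) = p / q); last by ring.
  by rewrite ln_div ?posrE// lerBlDr addrC.
have lnY : t * ln Y <= ln W.
  rewrite -ln_powR ler_ln ?posrE ?powR_gt0// (le_trans _ AtW)//.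
  by rewrite ge0_ler_powR ?nnegrE// ltW.
have lnA := lnle A Y A_gt0 Y0.
have lnW := lnle W A W0 A_gt0.
rewrite -/t -/Y.
set K' := K + _ in WA *.
have AY : A / Y = 1 - s / t * B / Y.
  rewrite (_ : A = Y - s / t * B); last by rewrite /Y; ring.
  by field; rewrite !gt_eqF.
have WA' : W / A <= 1 + k * K' / A.
  by rewrite ler_pdivrMr// mulrDl mul1r divfK// gt_eqF.
have key : s * (B / Y) - s * ln A <= k * K' / A.
  have h1 : t * ln A <= t * (ln Y + (A / Y - 1)) by rewrite ler_pM2l.
  have h2 : t * (A / Y - 1) = - (s * (B / Y)).
    by rewrite AY; field; rewrite !gt_eqF.
  have h3 : t * ln A = ln A - s * ln A by rewrite /t; ring.
  lra.
have -> : A * B / Y - A * ln A = A / s * (s * (B / Y) - s * ln A).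
  by field; rewrite !gt_eqF.
apply: le_trans (ler_wpM2l _ key) _; first by rewrite divr_ge0// ltW.
rewrite le_eqVlt; apply/orP; left; apply/eqP; rewrite /k.
by field; rewrite !gt_eqF.
Qed.

Lemma log_sobolev_bounded : B - A * ln A <= K / (2 * c).
Proof.
apply/ler_addgt0Pr => eta eta0.
set C := (2 * M + 1) * A.
have C0 : 0 < C by rewrite mulr_gt0//; have := M0; lra.
pose e := Num.min 1 (2 * c * eta / C).
have e0 : 0 < e by rewrite lt_min ltr01/= divr_gt0// !mulr_gt0.
have e1 : e <= 1 by rewrite ge_min lexx.
have eC : e * C <= 2 * c * eta.
  by rewrite -ler_pdivlMr// ge_min lexx orbT.
apply: (@le_trans _ _ ((K + e * C) / (2 * c))); last first.
  rewrite mulrDl lerD2l ler_pdivrMr ?mulr_gt0//.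
  by rewrite (le_trans eC)// mulrC.
have [d d0 Hd] := psi_slope e0.
have M1 : 0 < M + 1 by have := M0; lra.
(* The three bounds on [s = 1 - t] ensure in turn that [t >= 1/2], that
   [A + s / t * B > 0], and that beyond distance [d] the quadratic cost exceeds
   the oscillation [2 * M] of [psi]. *)
pose s0 := Num.min (1 / 2) (Num.min (2 * (M + 1))^-1 (c * d ^+ 2 / (8 * (M + 1)))).
have s00 : 0 < s0.
  rewrite !lt_min divr_gt0//= invr_gt0 mulr_gt0//=.
  by rewrite divr_gt0// mulr_gt0// exprn_gt0.
apply: (@entropy_limit R A B (K + e * C) ((M + 1) ^+ 2 / c) c s0) => //.
move=> s /andP[sgt0]; rewrite !lt_min => /and3P[s1 s2 s3].
apply: (log_sobolev_step _ d0 Hd) => //; first by rewrite e0.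
- exact: ltW.
- by rewrite -ler_pdivlMr ?mulr_gt0// mul1r ltW.
- by rewrite -ler_pdivlMr ?mulr_gt0// ltW.
Qed.

End bounded_log_sobolev.

(** * Functions that are constant outside a ball *)

(** A quadratic bound on the remainder yields the derivative without case
    analysis, in particular at the kink of [max 0 u]. *)
Lemma is_derive_quadratic_error (R : realType) (q : R -> R) (x d C : R) :
  (forall h, `|q (x + h) - q x - d * h| <= C * h ^+ 2) ->
  is_derive x (1 : R) q d.
Proof.
move=> H.
have C0 : 0 <= C.
  by have := H 1; rewrite expr1n !mulr1; exact: le_trans.
have cq : h^-1 *: ((q \o shift x) (h *: (1 : R)) - q x) @[h --> 0^'] --> d.
  apply/cvgrPdist_le => e e0; near=> h.
  have h0 : h != 0 by near: h; exact: nbhs_dnbhs_neq.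
  have he : `|h| <= e / (C + 1).
    near: h; apply: dnbhs0_le; rewrite divr_gt0//; lra.
  rewrite /= /GRing.scale/= mulr1 -normrN opprB.
  rewrite (_ : _ - d = (q (x + h) - q x - d * h) / h); last first.
    by rewrite (addrC h); field.
  rewrite normrM normfV ler_pdivrMr ?normr_gt0//.
  apply: le_trans (H h) _; rewrite -[h ^+ 2]real_normK ?num_real// expr2 mulrA.
  rewrite ler_pM2r ?normr_gt0//.
  apply: (@le_trans _ _ ((C + 1) * `|h|)); first by rewrite ler_wpM2r//; lra.
  by rewrite mulrC -ler_pdivlMr//; lra.
apply: DeriveDef; first by apply/cvg_ex; exists d.
exact: cvg_lim cq.
Unshelve. all: by end_near. Qed.

Lemma is_derive_sqr_pospart (R : realType) (x : R) :
  is_derive x (1 : R) (fun u : R => Num.max 0 u ^+ 2) (2 * Num.max 0 x).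
Proof.
apply: (@is_derive_quadratic_error _ _ _ _ 1) => h.
rewrite ler_norml !mul1r /Num.max.
case: ifPn => hx; case: ifPn => hy; rewrite -?leNgt in hx hy *;
  rewrite ?expr0n/=; apply/andP; split; nra.
Qed.

Section compact_support.
Context {R : realType} {n : nat}.
Implicit Types (f : 'rV[R]_n -> R) (x z : 'rV[R]_n).

Lemma norm_le_norm2 x : `|x| <= norm2 x.
Proof.
rewrite [leLHS]/Num.Def.normr /= mx_normrE; apply/bigmax_leP; split; first exact: norm2_ge0.
move=> [i j] _ /=; rewrite (ord1 i) -sqrtr_sqr ler_wsqrtr// (bigD1 j)//= lerDl.
by rewrite sumr_ge0// => l _; rewrite sqr_ge0.
Qed.

Lemma compact_norm_ball (r : R) : compact [set x : 'rV[R]_n | `|x| <= r].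
Proof.
apply: bounded_closed_compact.
  exists r; split; first exact: num_real.
  by move=> y ry x /= /le_trans; apply; exact: ltW.
rewrite (_ : mkset _ = (fun x : 'rV[R]_n => `|x|) @^-1` [set y | y <= r]) //.
apply: closed_comp; last exact: closed_le.
by move=> x _; exact: norm_continuous.
Qed.

(** Compactness of the ball. *)
Lemma bounded_of_cst_outside f (r l : R) : continuous f ->
  (forall x, r < norm2 x -> f x = l) -> exists C, forall x, `|f x| <= C.
Proof.
move=> cf fl.
have : compact (f @` [set x : 'rV[R]_n | `|x| <= r]).
  apply: continuous_compact; last exact: compact_norm_ball.
  exact: continuous_subspaceT.
move=> /(@compact_bounded R R)[C [_ HC]].
exists (Num.max `|l| (C + 1)) => x.
have [xr|xr] := leP (norm2 x) r; last by rewrite fl// le_max lexx.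
rewrite le_max; apply/orP; right; apply: HC; first by rewrite ltrDl.
by exists x => //=; exact: le_trans (norm_le_norm2 x) xr.
Qed.

(** Heine-Cantor on the ball of radius [r + 1]: a point outside it and any point
    at distance at most 1 are both in the region where [f] is constant. *)
Lemma uniform_continuous_cst_outside f (r l e : R) : continuous f ->
  (forall x, r < norm2 x -> f x = l) -> 0 < e ->
  exists2 d, 0 < d & forall x z, norm2 (x - z) <= d -> f x <= f z + e.
Proof.
move=> cf fl e0.
have cov : near_covering [set x : 'rV[R]_n | `|x| <= r + 1].
  by apply/compact_near_coveringP; exact: compact_norm_ball.
pose P (d : R) (z : 'rV[R]_n) := forall x, norm2 (x - z) <= d -> f x <= f z + e.
have : \forall d \near (0:R)^'+, [set x : 'rV[R]_n | `|x| <= r + 1] `<=` P d.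
  apply: cov => z0 _.
  have /cvgrPdist_lt/(_ (e / 2)) := cf z0; rewrite divr_gt0// => /(_ isT).
  move=> near_z0; have [s /= s0 Hs] := (nbhs_normP z0 _).1 near_z0.
  have s20 : 0 < s / 2 by rewrite divr_gt0.
  exists ([set z | `|z0 - z| < s / 2], [set d | d < s / 2]) => /=.
    split; first by apply: (nbhs_normP z0 _).2; exists (s / 2).
    exact: nbhs_right_lt.
  move=> [z d] /= [zs ds] x xz.
  have := Hs z; have := Hs x; rewrite /ball_/= => Hx Hz.
  have {}Hz : `|f z0 - f z| < e / 2 by apply: Hz; rewrite (lt_trans zs)//; lra.
  have {}Hx : `|f z0 - f x| < e / 2.
    apply: Hx; rewrite (_ : z0 - x = (z0 - z) - (x - z)); last first.
      by rewrite opprB addrA subrK.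
    apply: le_lt_trans (ler_normB _ _) _.
    have := le_trans (norm_le_norm2 _) xz; lra.
  move: Hz Hx; rewrite !ltr_norml => /andP[h1 h2] /andP[h3 h4].
  lra.
move=> near_d; near (0:R)^'+ => d; exists d => // x z xz.
have [zr|zr] := leP `|z| (r + 1).
  suff : P d z by exact.
  suff : [set x : 'rV[R]_n | `|x| <= r + 1] `<=` P d by exact.
  by near: d.
have d1 : d <= 1 by near: d; exact: nbhs_right_le.
have xr : r < `|x|.
  have := le_trans (norm_le_norm2 _) xz.
  have := ler_normB x (x - z); rewrite opprB addrC subrK; lra.
have zN := lt_le_trans zr (norm_le_norm2 z).
rewrite (fl z) ?(fl x) ?lerDl ?(ltW e0)//; last lra.
exact: lt_le_trans xr (norm_le_norm2 _).
Unshelve. all: by end_near. Qed.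

End compact_support.

(** * Cutoff of an exponential *)

Section continuous_pointwise.
Context {R : realType} {T : topologicalType} {W : normedModType R}.

Lemma continuous_add (f g : T -> W) : continuous f -> continuous g ->
  continuous (fun x => f x + g x).
Proof. by move=> cf cg x; apply: cvgD; [exact: cf|exact: cg]. Qed.

Lemma continuous_sub (f g : T -> W) : continuous f -> continuous g ->
  continuous (fun x => f x - g x).
Proof. by move=> cf cg x; apply: cvgB; [exact: cf|exact: cg]. Qed.

Lemma continuous_scale (s : T -> R) (f : T -> W) : continuous s -> continuous f ->
  continuous (fun x => s x *: f x).
Proof. by move=> cf cg x; apply: cvgZ; [exact: cf|exact: cg]. Qed.

Lemma continuous_mul (f g : T -> R) : continuous f -> continuous g ->
  continuous (fun x => f x * g x).
Proof. by move=> cf cg x; apply: cvgM; [exact: cf|exact: cg]. Qed.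

Lemma continuous_div (f g : T -> R) : continuous f -> continuous g ->
  (forall x, g x != 0) -> continuous (fun x => f x / g x).
Proof.
by move=> cf cg g0 x; apply: cvgM; [exact: cf|apply: cvgV => //; exact: cg].
Qed.

End continuous_pointwise.

Lemma continuous_sum (R : realType) (T : topologicalType) n (f : 'I_n -> T -> R) :
  (forall i, continuous (f i)) -> continuous (fun x => \sum_(i < n) f i x).
Proof.
move=> cf; rewrite (_ : (fun x => _) = \sum_(i < n) f i); last first.
  by apply/funext => y; rewrite fct_sumE.
elim/big_ind: _ => [|g h cg ch|i _].
- by move=> x; exact: (@cst_continuous _ _ (0 : R) x).
- exact: continuous_add.
- exact: cf.
Qed.

Lemma norm2_continuous (R : realType) n : continuous (@norm2 R n).
Proof.
move=> x; apply: (@continuous_comp _ _ _ (fun y : 'rV[R]_n => \sum_i y 0 i ^+ 2)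
  Num.sqrt); last exact: sqrt_continuous.
apply: continuous_sum => i; have ci := @coord_continuous R 1 n 0 i.
exact: (continuous_mul ci ci).
Qed.

Section cutoff.
Context {R : realType} {n : nat}.
Implicit Types (x z w : 'rV[R]_n).

Definition cutoff (rho : R) x : R := Num.max 0 (1 - norm2 x ^+ 2 / rho ^+ 2).

Lemma cutoff_ge0 rho x : 0 <= cutoff rho x.
Proof. by rewrite le_max lexx. Qed.

Lemma cutoff_le1 rho x : cutoff rho x <= 1.
Proof.
rewrite ge_max ler01/= gerBl mulr_ge0 ?sqr_ge0//.
by rewrite invr_ge0 sqr_ge0.
Qed.

Lemma cutoff_eq0 rho x : 0 < rho -> rho <= norm2 x -> cutoff rho x = 0.
Proof.
move=> r0 rx; apply/max_idPl; rewrite subr_le0 ler_pdivlMr ?exprn_gt0// mul1r.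
by rewrite lerXn2r// nnegrE ?norm2_ge0// ltW.
Qed.

Lemma cutoff_continuous rho : continuous (cutoff rho).
Proof.
have cn := @norm2_continuous R n.
have ct : continuous (fun y : 'rV[R]_n => 1 - norm2 y ^+ 2 / rho ^+ 2).
  apply: continuous_sub; first exact: cst_continuous.
  apply: continuous_mul; last exact: cst_continuous.
  exact: (continuous_mul cn cn).
move=> x.
exact: (@continuous_max _ _ (fun=> 0) _ x (@cst_continuous _ _ (0 : R) x) (ct x)).
Qed.

Lemma is_derive_norm2_line z w (s : R) :
  is_derive s (1 : R) (fun r : R => norm2 (z + r *: w) ^+ 2)
    (2 * \sum_(i < n) (z + s *: w) 0 i * w 0 i).
Proof.
rewrite (_ : (fun r => _) = \sum_(i < n) (fun r : R => (z 0 i + r * w 0 i) ^+ 2)); last first.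
  apply/funext => r; rewrite fct_sumE sqr_norm2.
  by apply: eq_bigr => i _; rewrite !mxE.
rewrite mulr_sumr; apply: is_derive_sum => i.
apply: (@is_derive_quadratic_error _ _ _ _ (w 0 i ^+ 2)) => h.
rewrite !mxE [X in `|X|](_ : _ = w 0 i ^+ 2 * h ^+ 2); last by ring.
by rewrite ger0_norm// mulr_ge0// sqr_ge0.
Qed.

Lemma is_derive_sqr_cutoff_line rho z w (s : R) :
  is_derive s (1 : R) (fun r : R => cutoff rho (z + r *: w) ^+ 2)
    (- (4 * cutoff rho (z + s *: w) / rho ^+ 2) *
     \sum_(i < n) (z + s *: w) 0 i * w 0 i).
Proof.
have dn := is_derive_norm2_line z w s.
have dt : is_derive s (1 : R) (fun r : R => 1 - norm2 (z + r *: w) ^+ 2 / rho ^+ 2)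
    (0 - (rho ^+ 2)^-1 * (2 * \sum_(i < n) (z + s *: w) 0 i * w 0 i)).
  apply: is_deriveB.
  rewrite (_ : (fun r => _) =
    (rho ^+ 2)^-1 \*: (fun r : R => norm2 (z + r *: w) ^+ 2)).
    exact: is_deriveZ.
  by apply/funext => r; rewrite /= /GRing.scale/= mulrC.
have := is_derive1_comp (is_derive_sqr_pospart _) dt.
rewrite (_ : _ \o _ = (fun r => cutoff rho (z + r *: w) ^+ 2))//.
move=> H; apply: is_derive_eq; rewrite /cutoff; ring.
Qed.

Variables (phi : 'rV[R]_n -> R) (rho : R).
Hypothesis rho0 : 0 < rho.
Hypothesis dphi : forall x, differentiable phi x.
Hypothesis cgrad : continuous (gradient phi).

(** The constant [rho^-1] keeps the logarithm bounded below; the square makes the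
    cut-off function continuously differentiable. *)
Definition truncation x : R := rho^-1 + cutoff rho x ^+ 2 * expR (phi x).

(** The gradient of [ln truncation], see [is_derive_ln_truncation_line]; the term
    in [x] comes from the gradient [-2 x / rho^2] of [1 - |x|^2 / rho^2]. *)
Definition ln_truncation_gradient x : 'rV[R]_n :=
  (expR (phi x) / truncation x) *:
  (cutoff rho x ^+ 2 *: gradient phi x - (4 * cutoff rho x / rho ^+ 2) *: x).

Let cphi : continuous phi.
Proof. by move=> x; exact: differentiable_continuous. Qed.

Let cexp : continuous (fun x => expR (phi x)).
Proof.
move=> x; apply: (@continuous_comp _ _ _ phi expR); first exact: cphi.
exact: continuous_expR.
Qed.

Let ccut2 : continuous (fun x => cutoff rho x ^+ 2).
Proof.
have cc := @cutoff_continuous rho.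
exact: (continuous_mul cc cc).
Qed.

Lemma truncation_continuous : continuous truncation.
Proof.
apply: continuous_add; first exact: cst_continuous.
exact: continuous_mul.
Qed.

Lemma truncation_gt0 x : 0 < truncation x.
Proof.
by rewrite ltr_wpDr ?invr_gt0// mulr_ge0 ?sqr_ge0 ?expR_ge0.
Qed.

Lemma ln_truncation_continuous : continuous (fun x => ln (truncation x)).
Proof.
move=> x; apply: (@continuous_comp _ _ _ truncation (@ln R)).
  exact: truncation_continuous.
by apply: continuous_ln; exact: truncation_gt0.
Qed.

Lemma ln_truncation_gradient_continuous : continuous ln_truncation_gradient.
Proof.
apply: continuous_scale.
  apply: continuous_div => //; first exact: truncation_continuous.
  by move=> x; rewrite gt_eqF// truncation_gt0.
apply: continuous_sub; first exact: continuous_scale.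
apply: continuous_scale; last by move=> x; exact: cvg_id.
apply: continuous_mul; last exact: cst_continuous.
apply: continuous_mul; [exact: cst_continuous|exact: cutoff_continuous].
Qed.

Lemma is_derive_ln_truncation_line z w (s : R) :
  is_derive s (1 : R) (fun r : R => ln (truncation (z + r *: w)))
    (\sum_(i < n) ln_truncation_gradient (z + s *: w) 0 i * w 0 i).
Proof.
have dp := is_derive_line (dphi (z + s *: w)).
have de := is_derive1_comp (is_derive_expR _) dp.
have dc := is_derive_sqr_cutoff_line rho z w s.
have dm := is_deriveM dc de.
have dt : is_derive s (1 : R) (fun r : R => truncation (z + r *: w)) _ :=
  is_deriveD (is_derive_cst rho^-1 s 1) dm.
have := @is_derive1_comp R (@ln R) (fun r => truncation (z + r *: w)) s _ _
  (is_derive1_ln (truncation_gt0 (z + s *: w))) dt.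
move=> H; apply: is_derive_eq.
set y := z + s *: w.
set S1 := \sum_(i < n) w 0 i * _; set S2 := \sum_(i < n) y 0 i * w 0 i.
have -> : \sum_(i < n) ln_truncation_gradient y 0 i * w 0 i =
    (expR (phi y) / truncation y) *
    (cutoff rho y ^+ 2 * S1 - (4 * cutoff rho y / rho ^+ 2) * S2).
  rewrite /S1 /S2 !mulr_sumr -sumrB mulr_sumr; apply: eq_bigr => i _.
  by rewrite /ln_truncation_gradient !mxE; ring.
rewrite /GRing.scale/= -/y; ring.
Qed.

End cutoff.

Section truncation_log_sobolev.
Context {R : realType} {n : nat}.
Implicit Types (x z w : 'rV[R]_n).
Variables (phi : 'rV[R]_n -> R) (rho : R).
Hypothesis rho0 : 0 < rho.
Hypothesis dphi : forall x, differentiable phi x.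
Hypothesis cgrad : continuous (gradient phi).

Local Notation f := (truncation phi rho).
Local Notation P := (ln_truncation_gradient phi rho).

Lemma truncation_outside x : rho <= norm2 x -> f x = rho^-1.
Proof. by move=> rx; rewrite /truncation cutoff_eq0// expr0n mul0r addr0. Qed.

Lemma ln_truncation_gradient_outside x : rho <= norm2 x -> P x = 0.
Proof.
move=> rx; rewrite /ln_truncation_gradient cutoff_eq0//.
by rewrite expr0n/= mulr0 mul0r !scale0r subrr scaler0.
Qed.

Lemma norm2_0 : norm2 (0 : 'rV[R]_n) = 0.
Proof. by rewrite -(scale0r (0 : 'rV[R]_n)) norm2Z normr0 mul0r. Qed.

Let slope_continuous : continuous (fun x => norm2 (P x)).
Proof.
move=> x; apply: (@continuous_comp _ _ _ P (@norm2 R n)).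
  exact: ln_truncation_gradient_continuous.
exact: norm2_continuous.
Qed.

(** Mean value theorem on the segment from [z] to [x], then Cauchy-Schwarz and the
    uniform continuity of the gradient norm. *)
Lemma truncation_ln_slope e : 0 < e -> exists2 d, 0 < d &
  forall x z, norm2 (x - z) <= d ->
    ln (f x) <= ln (f z) + (norm2 (P z) + e) * norm2 (x - z).
Proof.
move=> e0.
have slope0 x : rho < norm2 x -> norm2 (P x) = 0.
  by move=> /ltW rx; rewrite ln_truncation_gradient_outside// norm2_0.
have [d d0 Hd] := uniform_continuous_cst_outside slope_continuous slope0 e0.
exists d => // x z xz; set w := x - z.
pose q (r : R) := ln (f (z + r *: w)).
have dq r : is_derive r (1 : R) q (\sum_(i < n) P (z + r *: w) 0 i * w 0 i).
  exact: is_derive_ln_truncation_line.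
have cq : {within `[0, 1], continuous q}.
  apply: derivable_within_continuous => r _; exact: ex_derive.
have [r r01] := MVT ltr01 (fun r _ => dq r) cq.
rewrite /q scale1r scale0r addr0 subr0 mulr1 {1}/w (addrC z) subrK => E.
rewrite -lerBlDl E; apply: le_trans (cauchy_schwarz _ _) _.
rewrite ler_wpM2r ?norm2_ge0//; apply: Hd.
rewrite addrC addrA addNr add0r norm2Z.
move: r01; rewrite in_itv/= => /andP[r0 r1].
rewrite gtr0_norm//; apply: le_trans xz.
by rewrite -/w ler_piMl ?norm2_ge0// ltW.
Qed.

(** Where the cutoff [k] does not vanish, the gradient of the truncation is
    [k e^phi (k grad phi - (4/rho^2) x)], the truncation is at least [k^2 e^phi],
    and [|x| < rho]. *)
Lemma truncation_energy x :
  f x * norm2 (P x) ^+ 2 <=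
  expR (phi x) * (2 * norm2 (gradient phi x) ^+ 2 + 32 / rho ^+ 2).
Proof.
have rho2 : 0 < rho ^+ 2 by rewrite exprn_gt0.
have rhs0 : 0 <= 2 * norm2 (gradient phi x) ^+ 2 + 32 / rho ^+ 2.
  apply: addr_ge0; first by rewrite mulr_ge0 ?sqr_ge0.
  by rewrite divr_ge0// ltW.
have [rx|xr] := leP rho (norm2 x).
  rewrite ln_truncation_gradient_outside// norm2_0 expr0n mulr0.
  by rewrite mulr_ge0 ?expR_ge0.
have f0 : 0 < f x by exact: truncation_gt0.
set k := cutoff rho x; set g := gradient phi x; set e := expR (phi x).
have k0 : 0 <= k by exact: cutoff_ge0.
have k1 : k <= 1 by exact: cutoff_le1.
have e0 : 0 < e by exact: expR_gt0.
have -> : P x = (e / f x * k) *: (k *: g - (4 / rho ^+ 2) *: x).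
  by apply/rowP => i; rewrite /ln_truncation_gradient !mxE -/e -/k -/g; ring.
rewrite norm2Z exprMn real_normK ?num_real//.
clearbody g.
set S := norm2 (k *: g - _) ^+ 2.
have S_le : S <= 2 * norm2 g ^+ 2 + 32 / rho ^+ 2.
  apply: (@le_trans _ _ (2 * k ^+ 2 * norm2 g ^+ 2 +
      32 / rho ^+ 2 * (norm2 x ^+ 2 / rho ^+ 2))); last first.
    apply: lerD.
      rewrite -mulrA ler_pM2l// ler_piMl ?sqr_ge0//.
      by rewrite expr_le1.
    rewrite ler_piMr// ?mulr_ge0 ?invr_ge0 ?sqr_ge0//.
    by rewrite ler_pdivrMr// mul1r lerXn2r// ?nnegrE ?norm2_ge0// ltW.
  rewrite /S !sqr_norm2 !(mulr_sumr, mulr_suml) -big_split/=.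
  apply: ler_sum => i _; rewrite !mxE.
  set a := k * g 0 i; set b := 4 / rho ^+ 2 * x 0 i.
  have -> : 2 * k ^+ 2 * g 0 i ^+ 2 = 2 * a ^+ 2 by rewrite /a; ring.
  have -> : 32 / rho ^+ 2 * (x 0 i ^+ 2 / rho ^+ 2) = 2 * b ^+ 2.
    by rewrite /b; field; rewrite gt_eqF.
  have := sqr_ge0 (a + b); lra.
have fk : e * k ^+ 2 <= f x.
  by rewrite /truncation -/k -/e mulrC lerDr invr_ge0 ltW.
have -> : f x * ((e / f x * k) ^+ 2 * S) = e * ((e * k ^+ 2 / f x) * S).
  by field; rewrite gt_eqF.
rewrite ler_pM2l//; apply: le_trans S_le.
by rewrite ler_piMl ?sqr_ge0// ler_pdivrMr// mul1r.
Qed.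

Variables (nu : probability (borel_rV R n) R) (V : 'rV[R]_n -> R) (c : R).
Hypothesis nuV : forall A : set (borel_rV R n), measurable A ->
  nu A = (\int[lebesgue_rV]_(x in A) (expR (- V x))%:E)%E.
Hypothesis mV : measurable_fun setT (V : borel_rV R n -> R).
Hypothesis c0 : 0 < c.
Hypothesis convV : forall t x y, 0 < t < 1 ->
  V (t *: x + (1 - t) *: y) <=
  t * V x + (1 - t) * V y - c / 2 * (t * (1 - t)) * norm2 (x - y) ^+ 2.

Lemma truncation_bounded : exists C, forall x, `|ln (f x)| <= C.
Proof.
apply: (@bounded_of_cst_outside R n _ rho (ln rho^-1)).
  exact: ln_truncation_continuous.
by move=> x /ltW rx; rewrite truncation_outside.
Qed.

Lemma log_sobolev_truncation :
  \int[nu]_x (f x * ln (f x)) - (\int[nu]_x f x) * ln (\int[nu]_x f x) <=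
  (\int[nu]_x (f x * norm2 (P x) ^+ 2)) / (2 * c).
Proof.
have [C1 HC1] := truncation_bounded.
have [C2 HC2] : exists C, forall x, `|norm2 (P x)| <= C.
  apply: (@bounded_of_cst_outside R n _ rho 0); first exact: slope_continuous.
  by move=> x /ltW rx; rewrite ln_truncation_gradient_outside// norm2_0.
have fE x : f x = expR (ln (f x)) by rewrite lnK// posrE truncation_gt0.
have := @log_sobolev_bounded R n nu V c nuV mV c0 convV (fun x => ln (f x))
  (fun x => norm2 (P x)) (Num.max C1 C2) _ _ _ _ truncation_ln_slope.
rewrite (_ : (fun x => expR (ln (f x))) = f); last first.
  by apply/funext => x; rewrite -fE.
rewrite (_ : (fun x => expR (ln (f x)) * ln (f x)) = fun x => f x * ln (f x)); last first.
  by apply/funext => x; rewrite -fE.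
rewrite (_ : (fun x => expR (ln (f x)) * norm2 (P x) ^+ 2) =
    fun x => f x * norm2 (P x) ^+ 2); last first.
  by apply/funext => x; rewrite -fE.
apply.
- by apply: continuous_measurable_rV1; exact: ln_truncation_continuous.
- by apply: continuous_measurable_rV1; exact: slope_continuous.
- by move=> x; rewrite le_max HC1.
- by move=> x; rewrite norm2_ge0/= le_max (le_trans (ler_norm _) (HC2 x)) orbT.
Qed.

End truncation_log_sobolev.

(** * Removing the cutoff *)

Section truncation_limit.
Context {R : realType} {n : nat}.
Variable phi : 'rV[R]_n -> R.

Lemma cutoff_cvg (x : 'rV[R]_n) : cutoff k.+1%:R x @[k --> \oo] --> (1 : R).
Proof.
have cN : 1 - norm2 x ^+ 2 / k.+1%:R ^+ 2 @[k --> \oo] --> (1 - norm2 x ^+ 2 * (0 * 0) : R).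
  apply: cvgB; first exact: cvg_cst.
  apply: cvgM; first exact: cvg_cst.
  rewrite (_ : (fun k => _) = (fun k : nat => k.+1%:R^-1 * k.+1%:R^-1 : R)); last first.
    by apply/funext => k; rewrite expr2 invfM.
  by apply: cvgM; exact: cvg_harmonic.
rewrite mulr0 mulr0 subr0 in cN.
have cmax : continuous (fun u : R => Num.max 0 u).
  have ci : continuous (fun u : R => u) by move=> u; exact: cvg_id.
  move=> u; exact: (@continuous_max R R (fun=> 0) (fun u : R => u) u
    (@cst_continuous _ _ (0 : R) u) (ci u)).
have := cvg_comp _ _ cN (cmax 1).
by rewrite (max_idPr (ler01 : (0 : R) <= 1)).
Qed.

Lemma truncation_cvg (x : 'rV[R]_n) :
  truncation phi k.+1%:R x @[k --> \oo] --> expR (phi x).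
Proof.
have -> : expR (phi x) = 0 + 1 * 1 * expR (phi x) by rewrite add0r !mul1r.
apply: cvgD; first exact: cvg_harmonic.
apply: cvgM; last exact: cvg_cst.
have cx := @cutoff_cvg x.
exact: (cvgM cx cx).
Qed.

Lemma truncation_le k (x : 'rV[R]_n) : truncation phi k.+1%:R x <= 1 + expR (phi x).
Proof.
rewrite lerD ?invf_le1 ?ler1n// ler_piMl ?expR_ge0//.
by rewrite expr_le1 ?cutoff_ge0// cutoff_le1.
Qed.

Lemma mul_ln_ge (y : R) : 0 < y -> -1 <= y * ln y.
Proof.
move=> y0; have yV0 : 0 < y^-1 by rewrite invr_gt0.
have /le_ln1Dx : -1 < y^-1 - 1 by lra.
rewrite (_ : 1 + (y^-1 - 1) = y^-1); last by ring.
rewrite lnV ?posrE// => h.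
have : y * - ln y <= y * (y^-1 - 1) by rewrite ler_pM2l.
rewrite mulrBr divff ?gt_eqF//; lra.
Qed.

End truncation_limit.

Lemma limn_einf_le (R : realType) (u : (\bar R)^nat) (v : R^nat) (l : R) :
  (forall k, u k <= (v k)%:E)%E -> v @ \oo --> l -> (limn_einf u <= l%:E)%E.
Proof.
move=> uv vl.
have vE : (EFin \o v) @ \oo --> l%:E.
  by apply: cvg_EFin => //; exact: nearW.
rewrite -(cvg_lim _ vE)// limn_einf_lim; apply: lee_lim.
- exact: is_cvg_einfs.
- by apply/cvg_ex; exists l%:E.
- apply: nearW => k; apply: le_trans (uv k).
  by apply: ereal_inf_lbound; exists k => //=.
Qed.

Section log_sobolev.
Context {R : realType} {n : nat}.
Variables (nu : probability (borel_rV R n) R) (V : 'rV[R]_n -> R) (c : R).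
Hypothesis nuV : forall A : set (borel_rV R n), measurable A ->
  nu A = (\int[lebesgue_rV]_(x in A) (expR (- V x))%:E)%E.
Hypothesis mV : measurable_fun setT (V : borel_rV R n -> R).
Hypothesis c0 : 0 < c.
Hypothesis convV : forall t (x y : 'rV[R]_n), 0 < t < 1 ->
  V (t *: x + (1 - t) *: y) <=
  t * V x + (1 - t) * V y - c / 2 * (t * (1 - t)) * norm2 (x - y) ^+ 2.
Variable phi : 'rV[R]_n -> R.
Hypothesis dphi : forall x, differentiable phi x.
Hypothesis cgrad : continuous (gradient phi).

Let F : borel_rV R n -> R := fun x => expR (phi x).
Let G : borel_rV R n -> R := fun x => expR (phi x) * norm2 (gradient phi x) ^+ 2.
Let f k : borel_rV R n -> R := truncation phi k.+1%:R.
Let P k := ln_truncation_gradient phi k.+1%:R.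

Let mphi : measurable_fun setT (phi : borel_rV R n -> R).
Proof.
by apply: continuous_measurable_rV1 => x; exact: differentiable_continuous.
Qed.

Let mF : measurable_fun setT F.
Proof. exact: measurableT_comp. Qed.

Let mgrad : measurable_fun setT
  ((fun x => norm2 (gradient phi x)) : borel_rV R n -> R).
Proof.
apply: continuous_measurable_rV1 => x.
apply: (@continuous_comp _ _ _ (gradient phi) (@norm2 R n)); first exact: cgrad.
exact: norm2_continuous.
Qed.

Let mG : measurable_fun setT G.
Proof. by apply: measurable_funM => //; exact: measurable_funX. Qed.

Let k0 k : 0 < k.+1%:R :> R. Proof. exact: ltr0Sn. Qed.

Let mf k : measurable_fun setT (f k).
Proof.
by apply: continuous_measurable_rV1; apply: truncation_continuous.
Qed.

Hypothesis iF : nu.-integrable setT (EFin \o F).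
Hypothesis iG : nu.-integrable setT (EFin \o G).

Let A := \int[nu]_x F x.
Let I := \int[nu]_x G x.

Let i1 : nu.-integrable setT (EFin \o (fun=> 1 : R)).
Proof.
apply: (@bounded_integrable _ _ _ _ _ 1); first exact: measurable_cst.
by move=> x; rewrite normr1.
Qed.

Let mFE : measurable_fun setT (EFin \o F).
Proof. exact/measurable_EFinP. Qed.

(** A function that is positive everywhere cannot be null almost everywhere for
    a probability. *)
Lemma Rintegral_expR_gt0 : 0 < A.
Proof.
rewrite lt_neqAle Rintegral_ge0 ?andbT; last by move=> x _; exact: expR_ge0.
rewrite eq_sym; apply/negP => /eqP A0.
have : (\int[nu]_x `|(F x)%:E| = 0)%E.
  transitivity (\int[nu]_x (F x)%:E)%E.
    by apply: eq_integral => x _; rewrite gee0_abs// lee_fin expR_ge0.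
  by rewrite -[LHS]fineK ?integrable_fin_num// -[fine _]/A A0.
move=> /(ae_eq_integral_abs nu measurableT mFE).1.
move=> [N [mN N0 subN]].
have NT : N = setT.
  apply/seteqP; split => // x _; apply: subN => /= H.
  by have /eqP := H Logic.I; rewrite eqe gt_eqF// expR_gt0.
have : (1 = 0 :> \bar R)%E.
  by rewrite -[RHS]N0 NT; apply/esym; exact: probability_setT.
by move/eqP; rewrite onee_eq0.
Qed.

Let cvgA : \int[nu]_x f k x @[k --> \oo] --> A.
Proof.
pose dom : borel_rV R n -> \bar R := fun x => (1 + F x)%:E.
have iF1 : nu.-integrable setT dom by exact: (integrableD measurableT i1 iF).
have cvf : {ae nu, forall x, [set: borel_rV R n] x ->
    (f k x)%:E @[k --> \oo] --> (EFin \o F) x}.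
  apply: aeW => x _; apply: cvg_EFin; first exact: nearW.
  exact: truncation_cvg.
have fF : {ae nu, forall x, forall k : nat, [set: borel_rV R n] x ->
    (`|(f k x)%:E| <= dom x)%E}.
  apply: aeW => x k _; rewrite /= lee_fin ger0_norm.
    exact: truncation_le.
  by apply: ltW; exact: truncation_gt0.
have mfE k : measurable_fun setT (EFin \o f k) by exact/measurable_EFinP.
have [_ _ cv] := dominated_convergence measurableT mfE mFE cvf iF1 fF.
have AE : (\int[nu]_x (F x)%:E)%E = A%:E.
  by rewrite /A /Rintegral fineK//; exact: integrable_fin_num.
have := fine_cvg; rewrite /= in cv.
move=> H; apply: H; rewrite -AE; exact: cv.
Qed.

(** The bounded case for the truncations at radius [k + 1], then Fatou's lemma on
    the left and dominated convergence on the right. *)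
Lemma log_sobolev_integrable :
  (\int[nu]_x (F x * phi x)%:E <= (A * ln A + I / c)%:E)%E.
Proof.
pose E k := \int[nu]_x (f k x * ln (f k x)).
pose u k := (\int[nu]_x f k x) * ln (\int[nu]_x f k x) +
   (2 * I + 32 / k.+1%:R ^+ 2 * A) / (2 * c) + 1.
have mflnf k : measurable_fun setT (fun x => f k x * ln (f k x)).
  by apply: measurable_funM => //; exact: measurableT_comp.
have mulln k x : -1 <= f k x * ln (f k x).
  by apply: mul_ln_ge; exact: truncation_gt0.
have Eu k : (\int[nu]_x (f k x * ln (f k x) + 1)%:E <= (u k)%:E)%E.
  have [C HC] := truncation_bounded (k0 k) dphi.
  have iflnf : nu.-integrable setT (EFin \o (fun x => f k x * ln (f k x))).
    apply: (@bounded_integrable _ _ _ _ _ (expR C * C)) => // x.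
    have fx0 : 0 < f k x by exact: truncation_gt0.
    have fxC : expR (ln (f k x)) <= expR C.
      by rewrite ler_expR; exact: le_trans (ler_norm _) (HC x).
    by rewrite normrM ler_pM ?HC// gtr0_norm//; rewrite lnK ?posrE in fxC.
  have -> : (\int[nu]_x (f k x * ln (f k x) + 1)%:E)%E = (E k + 1)%:E.
    under eq_integral do rewrite EFinD.
    rewrite integralD// integral_cst//= mul1e EFinD.
    rewrite (_ : nu _ = 1%E); last exact: probability_setT.
    by congr (_ + _)%E; rewrite /E /Rintegral fineK//; exact: integrable_fin_num.
  rewrite lee_fin lerD2r -lerBlDl.
  have := log_sobolev_truncation (k0 k) dphi cgrad nuV mV c0 convV.
  rewrite -/(f k) -/(E k) => /le_trans; apply.
  rewrite ler_pM2r ?invr_gt0 ?mulr_gt0//.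
  have iGF := integrableD measurableT (integrableZl measurableT 2 iG)
    (integrableZl measurableT (32 / k.+1%:R ^+ 2) iF).
  have energy x : f k x * norm2 (P k x) ^+ 2 <=
      2 * G x + 32 / k.+1%:R ^+ 2 * F x.
    have := truncation_energy phi (k0 k) x.
    by congr (_ <= _); rewrite /G /F; ring.
  have energy0 x : 0 <= f k x * norm2 (P k x) ^+ 2.
    by apply: mulr_ge0; [apply: ltW; exact: truncation_gt0|exact: sqr_ge0].
  have mP : measurable_fun setT ((fun x => norm2 (P k x)) : borel_rV R n -> R).
    apply: continuous_measurable_rV1 => x.
    apply: (@continuous_comp _ _ _ (P k) (@norm2 R n)).
      exact: ln_truncation_gradient_continuous.
    exact: norm2_continuous.
  rewrite /I /A -!RintegralZl// -RintegralD//.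
  - apply: le_Rintegral => //.
    apply: le_integrable iGF => //.
      apply/measurable_EFinP; apply: measurable_funM => //.
      exact: measurable_funX.
    move=> x _; rewrite /= lee_fin ger0_norm// (le_trans (energy x))//.
    exact: ler_norm.
  - exact: (integrableZl measurableT 2 iG).
  - exact: (integrableZl measurableT (32 / k.+1%:R ^+ 2) iF).
have ucvg : u @ \oo --> A * ln A + I / c + 1.
  have -> : A * ln A + I / c + 1 =
      A * ln A + (2 * I + 32 * (0 * 0) * A) / (2 * c) + 1.
    by field; rewrite gt_eqF.
  apply: cvgD; last exact: cvg_cst.
  apply: cvgD.
    apply: cvgM; first exact: cvgA.
    exact: (cvg_comp _ _ cvgA (continuous_ln Rintegral_expR_gt0)).
  apply: cvgM; last exact: cvg_cst.
  apply: cvgD; first exact: cvg_cst.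
  apply: cvgM; last exact: cvg_cst.
  apply: cvgM; first exact: cvg_cst.
  rewrite (_ : (fun k => _) = (fun k : nat => k.+1%:R^-1 * k.+1%:R^-1 : R)); last first.
    by apply/funext => k; rewrite expr2 invfM.
  by apply: cvgM; exact: cvg_harmonic.
have mFphi : measurable_fun setT (fun x => F x * phi x).
  exact: measurable_funM.
have Fphi x : -1 <= F x * phi x.
  by have := mul_ln_ge (expR_gt0 (phi x)); rewrite expRK.
have fat : (\int[nu]_x (F x * phi x + 1)%:E <= (A * ln A + I / c + 1)%:E)%E.
  apply: le_trans (limn_einf_le Eu ucvg).
  apply: le_trans (fatou nu measurableT _ _).
  - rewrite le_eqVlt; apply/orP; left; apply/eqP/eq_integral => x _.
    have fx : (fun k => (f k x * ln (f k x) + 1)%:E) @ \oo --> (F x * phi x + 1)%:E.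
      apply: cvg_EFin; first exact: nearW.
      rewrite /= /F -[X in _ * X + 1]expRK.
      apply: cvgD; last exact: cvg_cst.
      have cx := @truncation_cvg R n phi x.
      apply: (cvgM cx).
      exact: (cvg_comp _ _ cx (continuous_ln (expR_gt0 _))).
    by rewrite (cvg_limn_einf_sup fx).1.
  - by move=> k; apply/measurable_EFinP; exact: measurable_funD.
  - by move=> k x _; rewrite lee_fin; have := mulln k x; lra.
have iFphi1 : nu.-integrable setT (EFin \o (fun x => F x * phi x + 1)).
  apply/integrableP; split; first by apply/measurable_EFinP; exact: measurable_funD.
  apply: le_lt_trans (ltry (A * ln A + I / c + 1)).
  rewrite (le_trans _ fat)// le_eqVlt; apply/orP; left; apply/eqP/eq_integral => x _.
  by rewrite /= ger0_norm//; have := Fphi x; lra.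
have iFphi : nu.-integrable setT (EFin \o (fun x => F x * phi x)).
  have := integrableB measurableT iFphi1 i1.
  congr (_.-integrable _ _); apply/funext => x /=.
  by rewrite -EFinD addrK.
move: fat; under eq_integral do rewrite EFinD.
rewrite integralD// integral_cst//= mul1e EFinD.
rewrite (_ : nu _ = 1%E); last exact: probability_setT.
by rewrite leeD2rE.
Qed.

End log_sobolev.

(** * The inequality for a composition *)

(** The hypotheses give differentiability of [ln (a (h y))] but only that [a] is
    derivable at [h x]; comparing the derivatives of both sides along each
    coordinate line through [x] is enough. *)
Lemma gradient_ln_comp (R : realType) n (a : R -> R) (h : 'rV[R]_n -> R)
    (x : 'rV[R]_n) :
  differentiable h x -> derivable a (h x) 1 -> 0 < a (h x) ->
  differentiable (fun y => ln (a (h y))) x ->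
  gradient (fun y => ln (a (h y))) x =
  (derive1 a (h x) / a (h x)) *: gradient h x.
Proof.
move=> dh da ah0 dlnah; apply/rowP => i; rewrite !mxE.
pose w : 'rV[R]_n := delta_mx 0 i.
have line (f : 'rV[R]_n -> R) : differentiable f x ->
    is_derive (0 : R) (1 : R) (fun r => f (x + r *: w)) (partial i f x).
  move=> df; have := @is_derive_line R n f x w 0.
  by rewrite scale0r addr0 -derive_partial//; apply.
have dh' := line h dh.
have da' : is_derive (h (x + 0 *: w)) (1 : R) a (derive1 a (h x)).
  by rewrite scale0r addr0 derive1E; exact: derivableP.
have dln : is_derive (a (h (x + 0 *: w))) (1 : R) (@ln R) (a (h x))^-1.
  by rewrite scale0r addr0; exact: is_derive1_ln.
have d1 := @is_derive1_comp R a (fun r => h (x + r *: w)) 0 _ _ da' dh'.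
have d2 := @is_derive1_comp R (@ln R) (a \o (fun r => h (x + r *: w))) 0 _ _ dln d1.
have d3 := line _ dlnah.
have <- := @derive_val _ _ _ _ _ _ _ d3.
rewrite (@derive_val _ _ _ _ _ _ _ d2).
by rewrite mulrA [X in X * _ = _]mulrC.
Qed.
Theorem proposition6p3 (R : realType) (n : nat) (n_ge1 : (1 <= n)%N)
  (nu : probability (borel_rV R n) R) (g v : 'rV[R]_n -> R)
  (nu_density : forall A : set (borel_rV R n), measurable A ->
     nu A = (\int[lebesgue_rV]_(x in A) (g x)%:E)%E)
  (g_exp : forall x, g x = expR (- v x))
  (nu_log_concave : convex_function setT v)
  (gA' : classA' g)
  (c : R) (c_gt0 : 0 < c)
  (hess_v : forall x, mx_le c%:M (hessian v x))
  (a : R -> R)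
  (a_ge0 : forall t : R, 0 <= t -> 0 <= a t)
  (a_continuous : {within `[0, +oo[, continuous a})
  (a_increasing : {in `[0, +oo[ &, {homo a : s t / s <= t}})
  (a0 : a 0 = 0)
  (h : 'rV[R]_n -> R)
  (h_gt0 : forall x, 0 < h x)
  (h_measurable : measurable_fun [set: borel_rV R n] (h : borel_rV R n -> R))
  (h_C2 : class_C2 h)
  (* the next three conditions say that log (a h), its Hessian and a' (h),
     which all occur below, are defined at every point *)
  (ah_gt0 : forall x, 0 < a (h x))
  (ln_ah_diff2 : twice_differentiable (fun x => ln (a (h x))))
  (a_derivable : forall x, derivable a (h x) 1)
  (ah_superlinear : superlinear (fun x => - ln (a (h x)) + v x))
  (hess_ln_ah : exists2 c' : R, 0 < c' & forall x,
     mx_le (- c' *: hessian v x) (hessian (fun y => ln (a (h y))) x) /\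
     mx_lt (hessian (fun y => ln (a (h y))) x) (hessian v x)) :
  (\int[nu]_x (a (h x) * ln (a (h x)))%:E
     - (\int[nu]_x (a (h x))%:E) * lne (\int[nu]_x (a (h x))%:E)
   <= c^-1%:E *
      \int[nu]_x (derive1 a (h x) ^+ 2 / a (h x) * norm2 (gradient h x) ^+ 2)%:E)%E.
Proof.
pose phi x := ln (a (h x)).
have ahE x : a (h x) = expR (phi x) by rewrite lnK// posrE.
have [u [_ [du _] _ _ gE]] := gA'.
have uv : u = v.
  apply/funext => x; apply: oppr_inj; apply: expR_inj.
  by rewrite -g_exp gE.
rewrite {}uv in du.
have nuV (A : set (borel_rV R n)) : measurable A ->
    nu A = (\int[lebesgue_rV]_(x in A) (expR (- v x))%:E)%E.
  by move=> mA; rewrite nu_density//; apply: eq_integral => x _; rewrite g_exp.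
have mv : measurable_fun setT (v : borel_rV R n -> R).
  by apply: continuous_measurable_rV1 => x; apply: differentiable_continuous; exact: du.1.
have convv t (x y : 'rV[R]_n) : 0 < t < 1 -> v (t *: x + (1 - t) *: y) <=
    t * v x + (1 - t) * v y - c / 2 * (t * (1 - t)) * norm2 (x - y) ^+ 2.
  exact: strongly_convex.
have [dphi dgrad] := ln_ah_diff2.
have cgrad : continuous (gradient phi).
  by move=> x; apply: differentiable_continuous; exact: dgrad.
pose G x := expR (phi x) * norm2 (gradient phi x) ^+ 2.
have GE x : derive1 a (h x) ^+ 2 / a (h x) * norm2 (gradient h x) ^+ 2 = G x.
  rewrite /G -ahE /phi gradient_ln_comp//; last exact: h_C2.1.1.
  rewrite norm2Z exprMn real_normK ?num_real//.
  by field; rewrite gt_eqF.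
under [X in (_ <= _ * X)%E]eq_integral do rewrite GE.
have -> : (\int[nu]_x (a (h x) * ln (a (h x)))%:E =
    \int[nu]_x (expR (phi x) * phi x)%:E)%E.
  by apply: eq_integral => x _; rewrite -ahE.
have -> : (\int[nu]_x (a (h x))%:E = \int[nu]_x (expR (phi x))%:E)%E.
  by apply: eq_integral => x _; rewrite -ahE.
have mphi : measurable_fun setT (phi : borel_rV R n -> R).
  by apply: continuous_measurable_rV1 => x; exact: differentiable_continuous.
have mF : measurable_fun setT ((fun x => expR (phi x)) : borel_rV R n -> R).
  exact: measurableT_comp.
have mG : measurable_fun setT (G : borel_rV R n -> R).
  apply: measurable_funM => //; apply: measurable_funX.
  apply: continuous_measurable_rV1 => x.
  apply: (@continuous_comp _ _ _ (gradient phi) (@norm2 R n)).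
    exact: cgrad.
  exact: norm2_continuous.
have G0 x : 0 <= G x by rewrite mulr_ge0 ?sqr_ge0 ?expR_ge0.
have ge0_integrable (f : borel_rV R n -> R) : measurable_fun setT f ->
    (forall x, 0 <= f x) -> (\int[nu]_x (f x)%:E < +oo)%E ->
    nu.-integrable setT (EFin \o f).
  move=> mf f0 foo; apply/integrableP; split; first exact/measurable_EFinP.
  rewrite (eq_integral (EFin \o f))// => x _.
  by rewrite gee0_abs// lee_fin.
have [Foo|] := ltP (\int[nu]_x (expR (phi x))%:E)%E +oo%E; last first.
  rewrite leye_eq => /eqP ->.
  by rewrite /= addeNy leNye.
have iF := ge0_integrable _ mF (fun x => expR_ge0 (phi x)) Foo.
have [Goo|] := ltP (\int[nu]_x (G x)%:E)%E +oo%E; last first.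
  by rewrite leye_eq => /eqP ->; rewrite mulry gtr0_sg ?invr_gt0// mul1e leey.
have iG := ge0_integrable _ mG G0 Goo.
have lsi := log_sobolev_integrable nuV mv c_gt0 convv dphi cgrad iF iG.
have toR (f : borel_rV R n -> R) : nu.-integrable setT (EFin \o f) ->
    (\int[nu]_x (f x)%:E)%E = (\int[nu]_x f x)%:E.
  by move=> i_f; rewrite /Rintegral fineK//; exact: integrable_fin_num.
rewrite (toR _ iF) (toR _ iG).
have A0 : 0 < \int[nu]_x expR (phi x) by exact: Rintegral_expR_gt0.
rewrite lne_EFin// -EFinM -EFinM leeBlDr//.
by rewrite -EFinD addrC [X in _ + X]mulrC.
Qed.
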